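(* Let $E$ be a directed graph, let $G=G(E)$, let $K\subseteq A(\widetilde E)^\wedge$ be a closed $G$-invariant subset, and let $c:G*K\to\mathbf Z$ denote the restriction of the canonical cocycle to $G*K$. Then $c^{-1}(0)$ is an AF equivalence relation.
   Context: Graphs. A graph $E$ consists of a set $E^0$ of vertices, a set $E^1$ of edges, maps $o,t:E^1\to E^0$, and a reversal $e\mapsto\overline e$ on $E^1$ with $\overline{\overline e}=e$, $\overline e\ne e$, $o(\overline e)=t(e)$. A directed graph is a graph with a subset $E^1_+\subseteq E^1$ containing exactly one edge from each pair $\{e,\overline e\}$. (No finiteness or countability assumptions.) A path is a finite or infinite sequence $e_1e_2\cdots$ of edges with $t(e_{i-1})=o(e_i)$ and $e_i\ne\overline{e_{i-1}}$ for $i>1$; vertices are paths of length $0$; $\ell(p)$ is the length. It is directed if all $e_i\in E^1_+$ (length-zero paths are directed). $E^*$, $E^\infty$: finite, infinite paths; $E^*_+$, $E^\infty_+$: directed ones; $E^{**}=E^*\cup E^\infty$. For $v\in E^0$: $\Delta_1(v)=\{e\in E^1_+: o(e)=v\}$, $V(v)=\{t(p): p\in E^*_+, o(p)=v\}$, and for finite $F\subseteq\Delta_1(v)$, $V(v;F)=\{v\}\cup\bigcup_{e\in\Delta_1(v)\setminus F}V(t(e))$. Forests. A directed graph $T$ is a directed forest if between any two vertices there is at most one path in $T^*$. Let $\mathcal A(T)$ be the ring of subsets of $T^0$ consisting of finite disjoint unions of sets $V(v;F)$ and $\emptyset$, and $A(T)\subseteq\ell^\infty(T^0)$ the closed linear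 span of $\{\chi_B: B\in\mathcal A(T)\}$. Its spectrum $A(T)^\wedge$ is the set of $\mathcal A(T)$-ultrafilters, identified with $T^0\cup(T^\infty_+/\!\sim)$: $v\in T^0$ corresponds to $\{B: v\in B\}$, the class of $p=e_1e_2\cdots\in T^\infty_+$ to $\{B: V(o(e_j))\subseteq B\text{ for some }j\}$; $p\sim q$ iff some tail of $p$ equals some tail of $q$. Groupoids. $G(E)$ is the discrete groupoid $E^*$ with unit space $E^0$, $r(p)=o(p)$, $s(p)=t(p)$, $(e_1\cdots e_n)^{-1}=\overline{e_n}\cdots\overline{e_1}$, product = concatenation followed by cancellation of pairs $e\overline e$. $\widetilde E$ is the directed forest with vertices $E^*$, edges the pairs $(p,q)$ with $o(p)=o(q)$ and $p^{-1}q\in E^1$, directed when $p^{-1}q\in E^1_+$, $o(p,q)=p$, $t(p,q)=q$, $\overline{(p,q)}=(q,p)$. Let $\lambda(p)=o(p)$, extended to $A(\widetilde E)^\wedge$ ($\lambda$ is constant on components). $G(E)$ acts on $\widetilde E$ by left multiplication ($\alpha\cdot p$ defined when $s(\alpha)=\lambda(p)$), hence on $A(\widetilde E)^\wedge$. For $K\subseteq A(\widetilde E)^\wedge$ closed and $G$-invariant, $G*K=\{(\alpha,x)\in G\times K: s(\alpha)=\lambda(x)\}$ with relative product topology, $s(\alpha,x)=x$, $r(\alpha,x)=\alpha x$, $(\alpha,\beta x)(\beta,x)=(\alpha\beta,x)$, $(\alpha,x)^{-1}=(\alpha^{-1},\alpha x)$, an étale locally compact Hausdorff groupoid with unit space $K$.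 Canonical cocycle. For $x\in A(\widetilde E)^\wedge$ let $\underline x=x\in E^*$ if $x\in\widetilde E^0=E^*$; if $x\in\widetilde E^\infty_+/\!\sim$ let $\underline x=(p_0^{-1}p_1)(p_1^{-1}p_2)\cdots\in E^\infty$ where $(p_0,p_1)(p_1,p_2)\cdots$ is the unique infinite path in $\widetilde E$ with $p_0=\lambda(x)$ having a tail in the class $x$. For $(\alpha,y)\in G*A(\widetilde E)^\wedge$ there are unique $\beta_1,\beta_2\in G$ and $x\in A(\widetilde E)^\wedge$ with $s(\beta_1)=s(\beta_2)=\lambda(x)$, $\alpha=\beta_1\beta_2^{-1}$, $y=\beta_2x$, and no cancellations in the products $\beta_1\cdot\underline x$, $\beta_2\cdot\underline x$, $\beta_1\cdot\beta_2^{-1}$. Put $c(\alpha,y)=\ell(\beta_1)-\ell(\beta_2)$; $c$ is a continuous homomorphism to $\mathbf Z$. AF equivalence relation: a principal étale groupoid $H$ with totally disconnected unit space which is the union of an upward directed family (not necessarily a sequence) of open elementary subgroupoids; a groupoid is elementary if it is topologically isomorphic to a disjoint union of groupoids $X_j\times R_{n_j}$, where $X_j$ is a locally compact Hausdorff space (viewed as a groupoid of units) and $R_{n_j}$ is the full equivalence relation on a finite set with $n_j$ elements. *)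

(* Defs.v *)
From HB Require Import structures.
From mathcomp Require Import all_boot all_algebra.
From mathcomp Require Import all_classical topology.

Set Implicit Arguments.
Unset Strict Implicit.
Unset Printing Implicit Defensive.

Import GRing.Theory.

Local Open Scope classical_set_scope.

(** * Directed graphs and paths *)

(* Choice structures cost no generality: [gen_choiceMixin] puts one on every
   type. *)
Record graph := Graph {
  vert : choiceType;
  edge : choiceType;
  org : edge -> vert;
  ter : edge -> vert;
  ebar : edge -> edge;
  ebarK : forall e, ebar (ebar e) = e;
  ebar_neq : forall e, ebar e != e;
  org_ebar : forall e, org (ebar e) = ter e
}.

Record digraph := Digraph {
  ugraph :> graph;
  epos : pred (edge ugraph);
  epos_ebar : forall e, epos (ebar e) = ~~ epos e
}.

Section Paths.
Variable E : graph.
Implicit Types (e f : edge E) (v : vert E) (a : vert E * seq (edge E)).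

Definition estep : rel (edge E) :=
  fun e f => (ter e == org f) && (f != ebar e).

(* The vertex records the origin, so that vertices are paths of length 0. *)
Definition is_rpath a : bool :=
  (if a.2 is e :: _ then org e == a.1 else true) && sorted estep a.2.

Record rpath := RPath { rpval : vert E * seq (edge E); _ : is_rpath rpval }.

HB.instance Definition _ := [isSub for rpval].
HB.instance Definition _ := [Choice of rpath by <:].

Definition porg (p : rpath) : vert E := (rpval p).1.
Definition pseq (p : rpath) : seq (edge E) := (rpval p).2.
Definition pter (p : rpath) : vert E := last (porg p) (map (@ter E) (pseq p)).
Definition plen (p : rpath) : nat := size (pseq p).

Definition vpath v : rpath := @RPath (v, [::]) isT.

Definition is_ipath (w : nat -> edge E) : Prop :=
  forall i, estep (w i) (w i.+1).

Definition itail (k : nat) (w : nat -> edge E) : nat -> edge E :=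
  fun i => w (k + i).

Definition reduced (s : seq (edge E)) : bool :=
  sorted (fun e f => f != ebar e) s.

Definition ccons e (s : seq (edge E)) : seq (edge E) :=
  if s is f :: s' then if f == ebar e then s' else e :: s else [:: e].

Definition reduce (s : seq (edge E)) : seq (edge E) := foldr ccons [::] s.

Definition invs (s : seq (edge E)) : seq (edge E) := rev (map (@ebar E) s).

(* The operations of the groupoid of finite paths.  [pmul p q] is meaningful
   only when [pter p = porg q]; then the default value is not used
   ([rpval_pmul]).  The default value of [pinv] is never used
   ([rpval_pinv]). *)
Definition pmul (p q : rpath) : rpath :=
  insubd p (porg p, reduce (pseq p ++ pseq q)).
Definition pinv (p : rpath) : rpath :=
  insubd p (pter p, invs (pseq p)).

Lemma ter_ebar e : ter (ebar e) = org e.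
Proof. by rewrite -org_ebar ebarK. Qed.

Lemma ccons_reduced e s : reduced s -> reduced (ccons e s).
Proof.
case: s => [|f s] //= rs; case: ifPn => [_|ne] /=; last by rewrite ne.
exact: path_sorted rs.
Qed.

Lemma reduce_reduced s : reduced (reduce s).
Proof. by elim: s => //= e s IHs; apply: ccons_reduced. Qed.

Lemma reduce_id s : reduced s -> reduce s = s.
Proof.
elim: s => //= e s IHs rs; rewrite IHs; last exact: path_sorted rs.
by case: s rs {IHs} => //= f s /andP[/negPf-> _].
Qed.

Lemma cconsK e s : reduced s -> ccons (ebar e) (ccons e s) = s.
Proof.
case: s => [|f s] //= rs; first by rewrite ebarK eqxx.
case: ifPn => [/eqP fe|ne] /=; last by rewrite ebarK eqxx.
case: s rs => [|g s] /=; first by rewrite fe.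
by rewrite fe ebarK => /andP[/negPf-> _].
Qed.

Lemma foldr_reduced s t : reduced t -> reduced (foldr ccons t s).
Proof. by move=> rt; elim: s => //= e s IHs; apply: ccons_reduced. Qed.

Lemma foldr_ccons e s t : reduced t ->
  foldr ccons t (ccons e s) = ccons e (foldr ccons t s).
Proof.
move=> rt; case: s => [|f s] //=; case: ifPn => // /eqP->.
by rewrite /= -[in LHS](@cconsK (ebar e) (foldr ccons t s)) ?ebarK //;
  apply: foldr_reduced.
Qed.

Lemma foldr_reduce s t : reduced t ->
  foldr ccons t (reduce s) = foldr ccons t s.
Proof. by move=> rt; elim: s => //= e s IHs; rewrite foldr_ccons ?IHs. Qed.

Lemma invs_cons e s : invs (e :: s) = rcons (invs s) (ebar e).
Proof. by rewrite /invs /= rev_cons. Qed.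

Lemma invsK s : invs (invs s) = s.
Proof.
rewrite /invs map_rev revK -map_comp -[RHS]map_id.
by apply: eq_map => e /=; rewrite ebarK.
Qed.

Lemma foldr_invs s t : reduced t -> foldr ccons (foldr ccons t s) (invs s) = t.
Proof.
move=> rt; elim: s => [|e s IHs] //=.
by rewrite invs_cons foldr_rcons cconsK //; apply: foldr_reduced.
Qed.

Lemma reduced_invs s : reduced (invs s) = reduced s.
Proof.
rewrite /reduced /invs rev_sorted sorted_map.
apply: eq_sorted => e f /=; rewrite ebarK.
by congr (~~ _); rewrite eq_sym.
Qed.

Lemma reduce_invs s : reduce (invs s) = invs (reduce s).
Proof.
have rz : reduced (invs (reduce s)) by rewrite reduced_invs reduce_reduced.
have rw := reduce_reduced (invs s).
rewrite -[RHS]reduce_id // -[LHS](@foldr_invs (reduce s)) //.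
congr (foldr _ _ _); rewrite foldr_reduce //.
by have := @foldr_invs (invs s) [::] isT; rewrite invsK.
Qed.

(* [s] is a walk from [u] to [v], possibly with backtracking. *)
Fixpoint walk u s v : bool :=
  if s is e :: s' then (org e == u) && walk (ter e) s' v else u == v.

Lemma walk_cat u v w s t : walk u s v -> walk v t w -> walk u (s ++ t) w.
Proof.
elim: s u => [|e s IHs] u /=; first by move=> /eqP->.
by move=> /andP[-> /IHs]; apply.
Qed.

Lemma walk_invs u v s : walk u s v -> walk v (invs s) u.
Proof.
elim: s u => [|e s IHs] u /=; first by rewrite eq_sym.
move=> /andP[/eqP<- /IHs ws]; rewrite invs_cons -cats1.
by apply: (walk_cat ws); rewrite /= org_ebar ter_ebar !eqxx.
Qed.

Lemma walk_ccons u v e s : walk u (e :: s) v -> walk u (ccons e s) v.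
Proof.
case: s => //= f s /and3P[/eqP eu /eqP ft ws].
case: ifPn => [/eqP fe|_] /=; last by rewrite eu ft !eqxx.
by rewrite -eu -ter_ebar -fe.
Qed.

Lemma walk_reduce u v s : walk u s v -> walk u (reduce s) v.
Proof.
elim: s u => //= e s IHs u /andP[eu /IHs ws].
by apply: walk_ccons; rewrite /= eu.
Qed.

Lemma is_rpathE u s :
  is_rpath (u, s) = walk u s (last u (map (@ter E) s)) && reduced s.
Proof.
rewrite /is_rpath /=; elim: s u => [|e s IHs] u /=; first by rewrite eqxx.
rewrite -andbA; congr (_ && _).
case: s IHs => [|f s] IHs /=; first by rewrite eqxx.
have /= := IHs (ter e); rewrite /reduced /= => IH.
rewrite {1}/estep [ter e == _]eq_sym -!andbA.
rewrite andbCA IH -!andbA.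
by case: (f != ebar e); rewrite ?andbF //= ?andbA.
Qed.

Lemma walk_last u v s : walk u s v -> last u (map (@ter E) s) = v.
Proof. by elim: s u => [|e s IHs] u /=; [move/eqP | case/andP => _ /IHs]. Qed.

Lemma rpath_walk p : walk (porg p) (pseq p) (pter p).
Proof.
rewrite /pter /porg /pseq; have := valP p.
by rewrite /=; case: (rpval p) => u s; rewrite is_rpathE => /andP[].
Qed.

Lemma rpath_reduced p : reduced (pseq p).
Proof.
rewrite /pseq; have := valP p.
by rewrite /=; case: (rpval p) => u s; rewrite is_rpathE => /andP[].
Qed.

Lemma rpval_pmul p q : pter p = porg q ->
  rpval (pmul p q) = (porg p, reduce (pseq p ++ pseq q)).
Proof.
move=> pq; rewrite /pmul; apply: (@insubdK _ _ rpath p).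
have wpq : walk (porg p) (reduce (pseq p ++ pseq q)) (pter q).
  apply/walk_reduce/(walk_cat (rpath_walk p)).
  by rewrite pq; apply: rpath_walk.
by rewrite -topredE /= is_rpathE (walk_last wpq) wpq reduce_reduced.
Qed.

Lemma rpval_pinv p : rpval (pinv p) = (pter p, invs (pseq p)).
Proof.
rewrite /pinv; apply: (@insubdK _ _ rpath p).
have wp := walk_invs (rpath_walk p).
by rewrite -topredE /= is_rpathE (walk_last wp) wp reduced_invs rpath_reduced.
Qed.

Lemma pter_pinv p : pter (pinv p) = porg p.
Proof.
rewrite /pter /pseq /porg rpval_pinv /=.
exact: walk_last (walk_invs (rpath_walk p)).
Qed.

Lemma pseq_pinv_mul p q : porg p = porg q ->
  pseq (pmul (pinv p) q) = reduce (invs (pseq p) ++ pseq q).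
Proof.
move=> pq; rewrite {1}/pseq rpval_pmul /=; first by rewrite /pseq rpval_pinv.
by rewrite pter_pinv.
Qed.

Lemma pseq_pinv_mulC p q : porg p = porg q ->
  pseq (pmul (pinv q) p) = invs (pseq (pmul (pinv p) q)).
Proof.
move=> pq; rewrite !pseq_pinv_mul // -reduce_invs.
by rewrite /invs map_cat rev_cat -/(invs _) -/(invs (invs _)) invsK.
Qed.

End Paths.

HB.instance Definition _ (E : graph) :=
  hasNbhs.Build (rpath E) principal_filter.
HB.instance Definition _ (E : graph) := Discrete_ofNbhs.Build (rpath E) erefl.

(** * The spectrum of a directed graph *)

Section Spectrum.
Variable T : digraph.
Implicit Types (v : vert T) (F : set (edge T)) (B C : set (vert T)).

Definition directed (p : rpath T) : Prop := all (@epos T) (pseq p).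
Definition idirected (w : nat -> edge T) : Prop :=
  is_ipath w /\ forall i, epos (w i).

Definition Delta1 v : set (edge T) := [set e | epos e /\ org e = v].

Definition reach v : set (vert T) :=
  [set u | exists p : rpath T, [/\ directed p, porg p = v & pter p = u]].

Definition reachD v F : set (vert T) :=
  v |` \bigcup_(e in Delta1 v `\` F) reach (ter e).

Definition basic B : Prop :=
  exists v F, [/\ finite_set F, F `<=` Delta1 v & B = reachD v F].

Definition setringA : set (set (vert T)) :=
  [set B | exists (n : nat) (V : 'I_n -> set (vert T)),
     [/\ forall i, basic (V i), trivIset setT V & B = \bigcup_i V i]].

Definition ringfilter (U : set (set (vert T))) : Prop :=
  [/\ U `<=` setringA, U !=set0, ~ U set0,
      forall B C, U B -> U C -> U (B `&` C) &
      forall B C, U B -> setringA C -> B `<=` C -> U C].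

Definition ringultra (U : set (set (vert T))) : Prop :=
  ringfilter U /\ forall U', ringfilter U' -> U `<=` U' -> U' = U.

Record spec := Spec { ufval : set (set (vert T)); _ : ringultra ufval }.

HB.instance Definition _ := gen_eqMixin spec.
HB.instance Definition _ := gen_choiceMixin spec.

(* The Gelfand topology: the idempotents [\chi_B] of the algebra span a dense
   subspace, and the set of characters not vanishing at [\chi_B] is the set of
   ultrafilters containing [B]. *)
HB.instance Definition _ := isSubBaseTopological.Build spec
  setringA (fun B => [set x : spec | ufval x B]).

Definition vert_uf v : set (set (vert T)) := [set B | setringA B /\ B v].

Definition end_uf (w : nat -> edge T) : set (set (vert T)) :=
  [set B | setringA B /\ exists j, reach (org (w j)) `<=` B].

Definition starts (x : spec) v : Prop :=
  ufval x = vert_uf v \/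
  exists w, [/\ idirected w, org (w 0%N) = v & ufval x = end_uf w].

Lemma spec_inhabited (x : spec) : exists v : vert T, True.
Proof.
case: x => U [] [_ [B UB] U0 _ _] _; apply: contrapT => nv.
apply: U0; suff <- : B = set0 by [].
by apply/seteqP; split=> // v _; apply: nv; exists v.
Qed.

End Spectrum.

(** * The forest of a directed graph *)

Section Forest.
Variable E : digraph.

Definition is_cedge (a : rpath E * rpath E) : bool :=
  (porg a.1 == porg a.2) && (plen (pmul (pinv a.1) a.2) == 1%N).

Record cedge := CEdge { ceval : rpath E * rpath E; _ : is_cedge ceval }.

HB.instance Definition _ := [isSub for ceval].
HB.instance Definition _ := [Choice of cedge by <:].

Lemma is_cedge_swap (a : cedge) : is_cedge ((ceval a).2, (ceval a).1).
Proof.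
case: a => -[p q] /= /andP[/= /eqP pq]; rewrite /is_cedge /plen /= pq eqxx.
by rewrite pseq_pinv_mulC // size_rev size_map.
Qed.

Definition cebar (a : cedge) : cedge := CEdge (is_cedge_swap a).

Definition cepos (a : cedge) : bool :=
  all (@epos E) (pseq (pmul (pinv (ceval a).1) (ceval a).2)).

Lemma cebarK a : cebar (cebar a) = a.
Proof. by apply: val_inj => /=; case: a => -[p q]. Qed.

Lemma cebar_neq a : cebar a != a.
Proof.
apply/eqP => /(congr1 (@ceval)); case: a => -[p q] /= + [qp _].
rewrite qp => /andP[_]; rewrite /= /plen pseq_pinv_mul //.
by rewrite /reduce foldr_cat -/(reduce _) reduce_id ?rpath_reduced //
   -{1}[pseq p]reduce_id ?rpath_reduced // foldr_invs.
Qed.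

Lemma cepos_cebar a : cepos (cebar a) = ~~ cepos a.
Proof.
case: a => -[p q] /= /[dup] /andP[/= /eqP pq] + ?.
rewrite /cepos /= (pseq_pinv_mulC pq) /plen.
by case: (pseq _) => [|e [|]] //= _; rewrite epos_ebar !andbT.
Qed.

Definition forest_graph : graph :=
  @Graph (rpath E) cedge (fun a => (ceval a).1) (fun a => (ceval a).2) cebar
    cebarK cebar_neq (fun=> erefl).

Definition forest_of : digraph := @Digraph forest_graph cepos cepos_cebar.

End Forest.

(** * Topological groupoids *)

(* The operations live on an ambient type [X]; a groupoid is a subset [H] of
   [X] on which they satisfy the axioms, with the subspace topology.  Units
   are identified with arrows, and [gmul x y] is meaningful only when
   [gsrc x = grng y]. *)
Record gpd_ops (X : Type) := GpdOps {
  gsrc : X -> X;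
  grng : X -> X;
  gmul : X -> X -> X;
  ginv : X -> X
}.

Definition open_in (X : topologicalType) (A B : set X) : Prop :=
  exists2 U, open U & B = A `&` U.

Section Groupoids.
Variables (X : topologicalType) (D : gpd_ops X).
Local Notation s := (gsrc D).
Local Notation r := (grng D).
Local Notation "x ** y" := (gmul D x y) (at level 40, left associativity).
Local Notation inv := (ginv D).
Implicit Types H L : set X.

Definition gpd_closed H : Prop :=
  [/\ forall x, H x -> H (s x), forall x, H x -> H (r x),
      forall x, H x -> H (inv x) &
      forall x y, H x -> H y -> s x = r y -> H (x ** y)].

Definition is_groupoid H : Prop :=
  [/\ gpd_closed H,
      (forall x, H x -> [/\ s (s x) = s x, r (s x) = s x,
                            s (r x) = r x & r (r x) = r x]),
      (forall x y, H x -> H y -> s x = r y ->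
         s (x ** y) = s y /\ r (x ** y) = r x),
      (forall x y z, H x -> H y -> H z -> s x = r y -> s y = r z ->
         x ** (y ** z) = (x ** y) ** z) &
      (forall x, H x -> [/\ x ** s x = x, r x ** x = x,
         s (inv x) = r x /\ r (inv x) = s x,
         inv x ** x = s x & x ** inv x = r x])].

Definition gpd_units H : set X := s @` H.

Definition is_topological H : Prop :=
  [/\ is_groupoid H, {within H, continuous inv} &
      {within [set xy : X * X | [/\ H xy.1, H xy.2 & s xy.1 = r xy.2]],
         continuous (fun xy : X * X => xy.1 ** xy.2)}].

(* The source map is a local homeomorphism onto the unit space; since the
   inversion is a homeomorphism, so is the range map. *)
Definition is_etale H : Prop :=
  is_topological H /\
  forall x, H x -> exists U : set X,
    [/\ open U, U x, {in H `&` U &, injective s},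
        {within H `&` U, continuous s} &
        forall W, open W -> open_in (gpd_units H) (s @` (H `&` U `&` W))].

Definition is_principal H : Prop :=
  forall x y, H x -> H y -> s x = s y -> r x = r y -> x = y.

Definition is_subgroupoid L H : Prop := L `<=` H /\ gpd_closed L.

(* [H] is topologically isomorphic to the groupoid with operations [D']
   on the whole space [Y]. *)
Definition top_isomorphic H (Y : topologicalType) (D' : gpd_ops Y) : Prop :=
  exists g : Y -> X,
    [/\ set_bij setT H g, continuous g,
        forall U, open U -> open_in H (g @` U),
        forall y, g (gsrc D' y) = s (g y) /\ g (grng D' y) = r (g y) &
        forall y z, gsrc D' y = grng D' z -> g (gmul D' y z) = g y ** g z].

End Groupoids.

(* The disjoint union of the groupoids [Z j * R_(n j)], where [R_m] is the
   full equivalence relation on ['I_m]: the arrow [(j, (z, (a, b)))] has range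
   [a] and source [b].  Composable arrows have the same index, so that
   [tagged_as] only moves the second one to a convertible type. *)
Section ElementaryModel.
Variables (J : choiceType) (Z : J -> topologicalType) (n : J -> nat).

Definition elem_space : topologicalType :=
  {j : J & (Z j * discrete_topology ('I_(n j) * 'I_(n j)))%type}.

Definition elem_mk j (z : Z j) (a b : 'I_(n j)) : elem_space :=
  existT _ j (z, (a, b)).

Definition elem_ops : gpd_ops elem_space := {|
  gsrc := fun x => elem_mk (projT2 x).1 (projT2 x).2.2 (projT2 x).2.2;
  grng := fun x => elem_mk (projT2 x).1 (projT2 x).2.1 (projT2 x).2.1;
  gmul := fun x y =>
    elem_mk (projT2 x).1 (projT2 x).2.1 (tagged_as x y).2.2;
  ginv := fun x => elem_mk (projT2 x).1 (projT2 x).2.2 (projT2 x).2.1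
|}.

End ElementaryModel.

Definition is_elementary (X : topologicalType) (D : gpd_ops X) (H : set X)
    : Prop :=
  exists (J : choiceType) (Z : J -> topologicalType) (n : J -> nat),
    (forall j, hausdorff_space (Z j) /\ locally_compact [set: Z j]) /\
    top_isomorphic D H (elem_ops Z n).

(* Local compactness and the Hausdorff property of [H] are not listed: they
   follow from the last clause. *)
Definition is_AF (X : topologicalType) (D : gpd_ops X) (H : set X) : Prop :=
  [/\ is_etale D H, is_principal D H, totally_disconnected (gpd_units D H) &
      exists F : set (set X),
        [/\ F !=set0,
            forall L M, F L -> F M -> exists2 N, F N & L `|` M `<=` N,
            forall L, F L ->
              [/\ is_subgroupoid D L H, open_in H L & is_elementary D L] &
            H = \bigcup_(L in F) L]].

(** * The groupoid of a directed graph acting on the spectrum of its forest *)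

Section Action.
Variable E : digraph.
Local Notation Et := (forest_of E).
Implicit Types (x y : spec Et) (p q : rpath E).

(* All [p] with [starts x p] lie in the component of [x], hence have the same
   origin; the choice and the default value are immaterial. *)
Definition lambda x : vert E :=
  porg (xget (projT1 (cid (spec_inhabited x))) (starts x)).

Definition act_uf p x : set (set (vert Et)) :=
  [set B : set (vert Et) | setringA B /\
     ufval x [set q : rpath E | porg q = pter p /\ B (pmul p q)]].

(* When [pter p = lambda x], [act_uf p x] is an ultrafilter: the direct image
   of [x] under left multiplication by [p]. *)
Definition act p x : spec Et :=
  if pselect (ringultra (act_uf p x)) is left h then Spec h else x.

(* Finite and infinite paths, the latter being given by their edges. *)
Definition gpath : Type := (rpath E + (nat -> edge E))%type.

Definition gprefix (u : gpath) (k : nat) : seq (edge E) :=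
  match u with inl p => take k (pseq p) | inr w => mkseq w k end.

Definition is_underline x (u : gpath) : Prop :=
  match u with
  | inl p => ufval x = @vert_uf Et p
  | inr v => exists w : nat -> edge Et,
      [/\ is_ipath w, org (w 0%N) = vpath (lambda x),
          (exists k, idirected (itail k w) /\ ufval x = end_uf (itail k w)) &
          forall i, pseq (pmul (pinv (org (w i))) (ter (w i))) = [:: v i]]
  end.

Definition underline x : gpath :=
  xget (inl (vpath (lambda x))) (is_underline x).

Definition no_cancel p (u : gpath) : Prop :=
  forall k, reduced (pseq p ++ gprefix u k).

Definition transf (K : set (spec Et)) : set (rpath E * spec Et) :=
  [set a | K a.2 /\ pter a.1 = lambda a.2].

Definition transf_ops : gpd_ops (rpath E * spec Et) := {|
  gsrc := fun a => (vpath (lambda a.2), a.2);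
  grng := fun a => (vpath (lambda (act a.1 a.2)), act a.1 a.2);
  gmul := fun a b => (pmul a.1 b.1, b.2);
  ginv := fun a => (pinv a.1, act a.1 a.2)
|}.

Definition invariant_set (K : set (spec Et)) : Prop :=
  forall p x, pter p = lambda x -> K x -> K (act p x).

Definition decomposition (a : rpath E * spec Et) (b1 b2 : rpath E) x : Prop :=
  [/\ pter b1 = lambda x /\ pter b2 = lambda x,
      a.1 = pmul b1 (pinv b2) /\ a.2 = act b2 x,
      no_cancel b1 (underline x), no_cancel b2 (underline x) &
      no_cancel b1 (inl (pinv b2))].

(* The decomposition exists and is unique when [pter a.1 = lambda a.2]. *)
Definition cocycle (a : rpath E * spec Et) : int :=
  xget 0%R [set m | exists b1 b2 x,
    decomposition a b1 b2 x /\ m = ((plen b1)%:Z - (plen b2)%:Z)%R].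

Definition cocycle_kernel (K : set (spec Et)) : set (rpath E * spec Et) :=
  transf K `&` [set a | cocycle a = 0%R].

End Action.

(* Main.v *)
(* An ultrafilter [x] on the ring of the forest is studied through the sets of
   finite paths that contain a member of [x] ([evt x]).  Every [x] comes from a
   vertex or from a directed infinite path, so that for each finite word [s]
   the paths beginning with [s] either form such a set or avoid one.  Hence
   [x], like its reduced path, has well-defined initial segments, and the
   cocycle vanishes at [(p, y)] exactly when left multiplication by [p]
   eventually preserves lengths along [y].  Two points are thus related by the
   kernel when they differ in an initial segment of the same length only.

   For a finite set [F] of edges closed under reversal and [n : nat], restrict
   to the arrows [(p, y)] of the kernel for which [p] uses edges of [F] only and
   has length at most [2n].  These form an open subgroupoid.  Each point factors
   uniquely as [b x], where [b] is its longest initial segment of length at most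
   [n] with edges in [F], and its class consists of the points [b' x] with [b']
   one of the finitely many paths over [F] of the same length and endpoint for
   which [b' x] has no cancellation.  That set of paths is locally constant in
   [x], so the subgroupoid is elementary, and such subgroupoids form a directed
   family with union the kernel. *)
Require Import Defs.
From mathcomp Require Import all_boot all_algebra.
From mathcomp Require Import all_classical topology.
(* [all_classical] also defines [pinv]. *)
Import Defs.

Set Implicit Arguments.
Unset Strict Implicit.
Unset Printing Implicit Defensive.

Local Open Scope classical_set_scope.

(** * Words and the groupoid of finite paths *)

Section Words.
Variable E : graph.
Implicit Types (e f : edge E) (s t : seq (edge E)) (p q u : rpath E).

Lemma reduce_catl s t : reduce (reduce s ++ t) = reduce (s ++ t).
Proof.
by rewrite /reduce !foldr_cat -/(reduce _) -/(reduce t) foldr_reduce //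
  reduce_reduced.
Qed.

Lemma reduce_catr s t : reduce (s ++ reduce t) = reduce (s ++ t).
Proof.
by rewrite /reduce !foldr_cat -/(reduce t) -/(reduce (reduce t))
  [reduce (reduce t)]reduce_id // reduce_reduced.
Qed.

Lemma reduce_invsl s : reduce (invs s ++ s) = [::].
Proof.
by rewrite -reduce_catr /reduce foldr_cat -/(reduce _) -/(reduce (reduce s))
  reduce_id ?reduce_reduced // /reduce foldr_invs.
Qed.

Lemma reduce_invsr s : reduce (s ++ invs s) = [::].
Proof. by rewrite -{1}[s]invsK reduce_invsl. Qed.

Lemma invs_cat s t : invs (s ++ t) = invs t ++ invs s.
Proof. by rewrite /invs map_cat rev_cat. Qed.

Lemma size_invs s : size (invs s) = size s.
Proof. by rewrite size_rev size_map. Qed.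

Lemma reduced_catl s t : reduced (s ++ t) -> reduced s.
Proof. by rewrite /reduced => /cat_sorted2[]. Qed.

Lemma reduced_catr s t : reduced (s ++ t) -> reduced t.
Proof. by rewrite /reduced => /cat_sorted2[]. Qed.

(* Cancellation in a product of reduced words takes place at the junction
   only. *)
Lemma reduce_cat_split s t : reduced s -> reduced t ->
  exists s' c r, [/\ s = s' ++ invs c, t = c ++ r & reduce (s ++ t) = s' ++ r].
Proof.
move=> + rt; elim: s => [|e s IHs] rs.
  by exists [::], [::], t; rewrite /= reduce_id.
have [|s' [c [r [es et er]]]] := IHs; first exact: path_sorted rs.
have -> : reduce ((e :: s) ++ t) = ccons e (reduce (s ++ t)) by [].
case: s' es er => [|f s'] es er; last first.
  exists (e :: f :: s'), c, r; split => //; first by rewrite es.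
  rewrite er /=; move: rs; rewrite es /= => /andP[/negPf-> _] //.
rewrite er /= {er}; case: r et => [|f r] et.
  by exists [:: e], c, [::]; rewrite es.
rewrite /=; case: ifPn => [/eqP fe|_]; last first.
  by exists [:: e], c, (f :: r); rewrite es.
exists [::], (rcons c f), r; rewrite -cats1 invs_cat es et fe /= -catA.
by rewrite /invs /= ebarK.
Qed.

Lemma rpath_eq p q : porg p = porg q -> pseq p = pseq q -> p = q.
Proof.
move=> pq spq; apply: val_inj => /=; move: pq spq; rewrite /porg /pseq.
by case: (rpval p) (rpval q) => ? ? [? ?] /= -> ->.
Qed.

Lemma porg_pmul p q : pter p = porg q -> porg (pmul p q) = porg p.
Proof. by move=> pq; rewrite {1}/porg rpval_pmul. Qed.

Lemma pseq_pmul p q : pter p = porg q ->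
  pseq (pmul p q) = reduce (pseq p ++ pseq q).
Proof. by move=> pq; rewrite {1}/pseq rpval_pmul. Qed.

Lemma pter_pmul p q : pter p = porg q -> pter (pmul p q) = pter q.
Proof.
move=> pq; rewrite {1}/pter porg_pmul // pseq_pmul //.
apply: (@walk_last _ (porg p)); apply/walk_reduce/(walk_cat (rpath_walk p)).
by rewrite pq; apply: rpath_walk.
Qed.

Lemma porg_pinv p : porg (pinv p) = pter p.
Proof. by rewrite {1}/porg rpval_pinv. Qed.

Lemma pseq_pinv p : pseq (pinv p) = invs (pseq p).
Proof. by rewrite {1}/pseq rpval_pinv. Qed.

Lemma pinvK p : pinv (pinv p) = p.
Proof.
apply: rpath_eq; first by rewrite porg_pinv pter_pinv.
by rewrite !pseq_pinv invsK.
Qed.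

Lemma pmulA p q u : pter p = porg q -> pter q = porg u ->
  pmul p (pmul q u) = pmul (pmul p q) u.
Proof.
move=> pq qu; have pqu : pter p = porg (pmul q u) by rewrite porg_pmul.
have pqu' : pter (pmul p q) = porg u by rewrite pter_pmul.
apply: rpath_eq; first by rewrite !porg_pmul.
by rewrite !pseq_pmul // reduce_catl reduce_catr catA.
Qed.

Lemma pmulVp p : pmul (pinv p) p = vpath (pter p).
Proof.
have pp := pter_pinv p.
apply: rpath_eq; first by rewrite porg_pmul // porg_pinv.
by rewrite pseq_pmul // pseq_pinv reduce_invsl.
Qed.

Lemma pmulpV p : pmul p (pinv p) = vpath (porg p).
Proof. by rewrite -{1}[p]pinvK pmulVp pter_pinv. Qed.

Lemma pmul1p v p : v = porg p -> pmul (vpath v) p = p.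
Proof.
move=> vp; apply: rpath_eq; first by rewrite porg_pmul.
by rewrite pseq_pmul // reduce_id // rpath_reduced.
Qed.

Lemma pmulp1 v p : pter p = v -> pmul p (vpath v) = p.
Proof.
move=> vp; apply: rpath_eq; first by rewrite porg_pmul.
by rewrite pseq_pmul //= cats0 reduce_id // rpath_reduced.
Qed.

Lemma pmulKV p q : porg p = porg q -> pmul p (pmul (pinv p) q) = q.
Proof.
by move=> pq; rewrite pmulA ?pmulpV ?pmul1p ?pter_pinv ?porg_pinv.
Qed.

Lemma pmulVK p q : pter p = porg q -> pmul (pinv p) (pmul p q) = q.
Proof.
by move=> pq; rewrite pmulA ?pmulVp ?pmul1p ?pter_pinv ?porg_pinv.
Qed.

Lemma pmulK p q : pter p = porg q -> pmul (pmul p q) (pinv q) = p.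
Proof.
by move=> pq; rewrite -pmulA ?pmulpV ?pmulp1 ?porg_pinv.
Qed.

Lemma pinvM p q : pter p = porg q -> pinv (pmul p q) = pmul (pinv q) (pinv p).
Proof.
move=> pq; have qp : pter (pinv q) = porg (pinv p).
  by rewrite porg_pinv pter_pinv.
apply: rpath_eq; first by rewrite porg_pmul // !porg_pinv pter_pmul.
by rewrite pseq_pmul // !pseq_pinv pseq_pmul // -reduce_invs invs_cat.
Qed.

Lemma is_rpath_edge e : is_rpath (org e, [:: e]).
Proof. by rewrite /is_rpath /= eqxx. Qed.

Definition epath e : rpath E := RPath (is_rpath_edge e).

End Words.

(** * The sets V(p; F) in the forest *)

Lemma rpath_take (E : graph) (p : rpath E) s t : pseq p = s ++ t ->
  exists q u, [/\ porg q = porg p, pseq q = s, pter q = porg u, pseq u = t &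
    p = pmul q u].
Proof.
move=> ep; have rq : is_rpath (porg p, s).
  have /= := valP p; case E2 : (rpval p) => [v w].
  move: ep; rewrite /porg /pseq E2 /is_rpath /= => ->.
  by case: s => //= e s /andP[-> /=]; rewrite cat_path => /andP[].
pose q := RPath rq; have qp : porg q = porg p by [].
have pvq : pter (pinv q) = porg p by rewrite pter_pinv.
have qu : pter q = porg (pmul (pinv q) p).
  by rewrite porg_pmul ?porg_pinv.
exists q, (pmul (pinv q) p); split=> //; last by rewrite pmulKV.
rewrite pseq_pmul // pseq_pinv ep catA -reduce_catl reduce_invsl /=.
by rewrite reduce_id //; apply: (@reduced_catr _ s); rewrite -ep rpath_reduced.
Qed.

Section Cells.
Variable E : digraph.
Local Notation Et := (forest_of E).
Implicit Types (e f : edge E) (s t A : seq (edge E)) (p q u m w : rpath E).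

(** The labels along the path from [p] to [u] in the forest. *)
Definition dif p u : seq (edge E) := pseq (pmul (pinv p) u).

Definition starts_in A s : bool := if s is f :: _ then f \in A else false.

(* The set [V(p; F)] of the paper, with the edges of the forest that issue
   from [p] replaced by their labels.  Labels that do not occur in [Delta1 p]
   are allowed in [A]. *)
Definition cell p A : set (vert Et) :=
  [set u : rpath E | [/\ porg u = porg p, all (@epos E) (dif p u) &
    ~~ starts_in A (dif p u)]].

Lemma positive_reduced s : all (@epos E) s -> reduced s.
Proof.
elim: s => // e [|f s] IHs //= /and3P[pe pf ps].
apply/andP; split; last by apply: IHs; rewrite /= pf.
by apply: contraTneq pf => ->; rewrite epos_ebar pe.
Qed.

Lemma pseq_dif p u : porg p = porg u -> pseq u = reduce (pseq p ++ dif p u).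
Proof.
move=> pu; rewrite -pseq_pmul ?pmulKV // porg_pmul ?porg_pinv //.
by rewrite pter_pinv.
Qed.

Lemma difE p u : porg p = porg u -> dif p u = reduce (invs (pseq p) ++ pseq u).
Proof. exact: pseq_pinv_mul. Qed.

Lemma dif_refl p : dif p p = [::].
Proof. by rewrite difE // reduce_invsl. Qed.

Lemma dif_inj p u w : porg p = porg u -> porg p = porg w ->
  dif p u = dif p w -> u = w.
Proof.
move=> pu pw uw; apply: rpath_eq; first by rewrite -pu.
by rewrite (pseq_dif pu) (pseq_dif pw) uw.
Qed.

Lemma dif_sym p u : porg p = porg u -> dif u p = invs (dif p u).
Proof. exact: pseq_pinv_mulC. Qed.

Lemma dif_trans p m u : porg p = porg m -> porg m = porg u ->
  dif p u = reduce (dif p m ++ dif m u).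
Proof.
move=> pm mu; rewrite !difE //; last by rewrite pm.
rewrite reduce_catl reduce_catr -catA (catA (pseq m)).
rewrite -[in RHS]reduce_catr -[in RHS](reduce_catl (pseq m ++ _)).
by rewrite reduce_invsr /= reduce_catr.
Qed.

Lemma cell0P p u :
  cell p [::] u <-> porg u = porg p /\ all (@epos E) (dif p u).
Proof.
rewrite /cell /=; split=> [[]//|[-> ->]]; split=> //.
by rewrite /starts_in; case: (dif p u).
Qed.

Lemma cellP p A u : cell p A u <-> cell p [::] u /\ ~~ starts_in A (dif p u).
Proof. by rewrite cell0P /cell /=; split=> [[-> -> ->]|[[-> ->] ->]]. Qed.

Lemma cell_porg p A u : cell p A u -> porg u = porg p.
Proof. by case. Qed.

Lemma cell_refl p A : cell p A p.
Proof. by split=> //; rewrite dif_refl. Qed.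

Lemma sub_cell0 p A : cell p A `<=` cell p [::].
Proof. by move=> u /cellP[]. Qed.

Lemma dif_cat p m u : cell p [::] m -> cell m [::] u ->
  dif p u = dif p m ++ dif m u.
Proof.
move=> /cell0P[mp em] /cell0P[um eu].
rewrite (@dif_trans p m) ?reduce_id ?positive_reduced ?all_cat ?em ?eu //.
Qed.

Lemma cell_trans p m u : cell p [::] m -> cell m [::] u -> cell p [::] u.
Proof.
move=> pm mu; apply/cell0P; split.
  by rewrite (cell_porg mu) (cell_porg pm).
rewrite (dif_cat pm mu) all_cat.
by have /cell0P[_ ->] := pm; have /cell0P[_ ->] := mu.
Qed.

Lemma cell_split p u s t : cell p [::] u -> dif p u = s ++ t ->
  exists m, [/\ cell p [::] m, cell m [::] u, dif p m = s & dif m u = t].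
Proof.
move=> /cell0P[up eu] st; have [q [a [qo qs qa at_ ea]]] := rpath_take st.
have pu : pter (pinv p) = porg u by rewrite pter_pinv.
have pq : pter p = porg q by rewrite qo porg_pmul // porg_pinv.
have mo : porg (pmul p q) = porg u by rewrite porg_pmul.
have ds : dif p (pmul p q) = s by rewrite /dif pmulVK.
have dt : dif (pmul p q) u = t.
  have -> : u = pmul (pmul p q) a by rewrite -pmulA // -ea pmulKV.
  by rewrite /dif pmulVK // pter_pmul.
exists (pmul p q); move: eu; rewrite st all_cat => /andP[es et].
by split=> //; apply/cell0P; rewrite ?ds ?dt ?es ?et mo ?up.
Qed.

Lemma cell_prefix p m u : cell p [::] m -> cell p [::] u ->
  prefix (dif p m) (dif p u) -> cell m [::] u.
Proof.
move=> pm pu /prefixP[t et].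
have [m' [pm' m'u dm' _]] := cell_split pu et.
suff -> : m = m' by [].
by apply: (@dif_inj p); rewrite ?(cell_porg pm) ?(cell_porg pm').
Qed.

(** By [reduce_cat_split] only a block at the junction disappears, and inverting it shows that it is
    a suffix of [t] as well. *)
Lemma pos_cancel s t : all (@epos E) s -> all (@epos E) t ->
  exists s' t' z, [/\ s = s' ++ z, t = t' ++ z &
    reduce (s ++ invs t) = s' ++ invs t'].
Proof.
move=> es et; have rt : reduced (invs t).
  by rewrite reduced_invs positive_reduced.
have [s' [c [r [-> tc ->]]]] := reduce_cat_split (positive_reduced es) rt.
exists s', (invs r), (invs c); split=> //; last by rewrite invsK.
by rewrite -invs_cat -tc invsK.
Qed.

Lemma filter_posinv s t : all (@epos E) s -> all (@epos E) t ->
  seq.filter (@epos E) (s ++ invs t) = s /\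
  seq.filter (predC (@epos E)) (s ++ invs t) = invs t.
Proof.
move=> es et; have nt : all (predC (@epos E)) (invs t).
  rewrite /invs all_rev all_map; apply: sub_all et => e /=.
  by rewrite epos_ebar negbK.
have ns : seq.filter (predC (@epos E)) s = [::].
  by apply/eqP; rewrite -(negbK (_ == _)) -has_filter has_predC es.
have nt' : seq.filter (@epos E) (invs t) = [::].
  by apply/eqP; rewrite -(negbK (_ == _)) -has_filter -all_predC nt.
by rewrite !filter_cat (all_filterP es) (all_filterP nt) ns nt' cats0.
Qed.

(** The sign of a letter tells which factor it comes from, so filtering by [epos] recovers both. *)
Lemma posinv_inj s t s2 t2 : all (@epos E) s -> all (@epos E) t ->
  all (@epos E) s2 -> all (@epos E) t2 ->
  s ++ invs t = s2 ++ invs t2 -> s = s2 /\ t = t2.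
Proof.
move=> es et es2 et2 e.
have [a b] := filter_posinv es et; have [a2 b2] := filter_posinv es2 et2.
split; first by rewrite -a e.
by rewrite -[LHS]invsK -b e b2 invsK.
Qed.

(* [m] is the turning point of the path from [p] to [q] in the forest. *)
Lemma cell_meet p q u : cell p [::] u -> cell q [::] u ->
  exists m, [/\ cell p [::] m, cell q [::] m &
    forall w, cell p [::] w -> cell q [::] w -> cell m [::] w].
Proof.
(* Whatever the common descendant [w], the words [s] and [t] are read off [dif p q], so [posinv_inj]
   makes them independent of [w]. *)
have key w : cell p [::] w -> cell q [::] w ->
    exists s t z, [/\ all (@epos E) s /\ all (@epos E) t, dif p w = s ++ z,
      dif q w = t ++ z & dif p q = s ++ invs t].
  move=> /cell0P[wp sw] /cell0P[wq tw].
  have [s [t [z [es et e]]]] := pos_cancel sw tw.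
  exists s, t, z; split=> //.
    by move: sw tw; rewrite es et !all_cat => /andP[-> _] /andP[-> _].
  by rewrite -e -dif_sym -?wq ?wp // -dif_trans // -?wq ?wp.
move=> pu qu; have [s [t [z [[ps pt] es et e]]]] := key u pu qu.
have [m [pm mu dm dz]] := cell_split pu es.
have qm : cell q [::] m.
  have [m' [qm' m'u dm' dz']] := cell_split qu et.
  suff -> : m = m' by [].
  have um := cell_porg mu; have um' := cell_porg m'u.
  apply: (dif_inj um um').
  by rewrite (dif_sym (esym um)) (dif_sym (esym um')) dz dz'.
exists m; split=> // w pw qw.
have [s2 [t2 [z2 [[ps2 pt2] es2 et2]]]] := key w pw qw.
rewrite e => /(posinv_inj ps pt ps2 pt2)[ss tt].
by apply: cell_prefix pm pw _; rewrite dm ss es2 prefix_prefix.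
Qed.

Lemma starts_in_cat A s t : s != [::] -> starts_in A (s ++ t) = starts_in A s.
Proof. by case: s. Qed.

(** Common points lie below the turning point [m]. Seen from [m], a restriction imposed at another
    vertex is already decided by the first edge towards [m], while one imposed at [m] itself
    persists. *)
Lemma cellI p A q C :
  cell p A `&` cell q C = set0 \/ exists m B, cell p A `&` cell q C = cell m B.
Proof.
have [[u [pu qu]]|n] := pselect (exists u, cell p [::] u /\ cell q [::] u).
  have [m [pm qm H]] := cell_meet pu qu.
  have aux p' A' : cell p' [::] m -> (forall w, cell m [::] w -> ~ cell p' A' w)
     \/ exists B, forall w, cell m [::] w ->
       cell p' A' w <-> ~~ starts_in B (dif m w).
    move=> pm'; have [d0|d0] := eqVneq (dif p' m) [::].
      right; exists A' => w mw; rewrite cellP (dif_cat pm' mw) d0 /=.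
      by split=> [[]//|]; split=> //; apply: cell_trans mw.
    case hA : (starts_in A' (dif p' m)).
      by left=> w mw /cellP[_]; rewrite (dif_cat pm' mw) starts_in_cat // hA.
    right; exists [::] => w mw.
    rewrite cellP (dif_cat pm' mw) starts_in_cat // hA.
    split=> _; first by case: (dif m w).
    by split=> //; apply: cell_trans mw.
  have [nA|[B1 hB1]] := aux _ A pm.
    left; apply/seteqP; split=> // w [/[dup] pw /sub_cell0 pw0 /sub_cell0 qw0].
    by apply: (nA w) pw; apply: H.
  have [nC|[B2 hB2]] := aux _ C qm.
    left; apply/seteqP; split=> // w [/sub_cell0 pw0 /[dup] qw /sub_cell0 qw0].
    by apply: (nC w) qw; apply: H.
  right; exists m, (B1 ++ B2).
  have hU s : starts_in (B1 ++ B2) s = starts_in B1 s || starts_in B2 s.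
    by case: s => //= f s; rewrite mem_cat.
  apply/seteqP; split=> w.
    move=> [pw qw].
    have mw : cell m [::] w by apply: H; apply: sub_cell0; eauto.
    apply/cellP; split=> //; rewrite hU negb_or.
    by apply/andP; split; [apply/hB1 | apply/hB2].
  move=> /cellP[mw]; rewrite hU negb_or => /andP[h1 h2].
  by split; [apply/hB1 | apply/hB2].
left; apply/seteqP; split=> // w [/sub_cell0 pw /sub_cell0 qw].
by apply: n; exists w.
Qed.

Lemma cell_sep p A q : ~ cell p A q ->
  exists C, cell q C `&` cell p A = set0.
Proof.
move=> npq.
have [[u [pu qu]]|n] := pselect (exists u, cell p [::] u /\ cell q [::] u).
  have [m [pm qm H]] := cell_meet pu qu.
  (* The label of the first edge from [q] towards [m]; the list is empty when [m = q]. *)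
  exists (take 1 (dif q m)); apply/seteqP; split=> // w [qw pw].
  have mw := H _ (sub_cell0 pw) (sub_cell0 qw).
  have [d0|d0] := eqVneq (dif q m) [::].
    have qe : m = q.
      by apply: (@dif_inj q); rewrite ?(cell_porg qm) ?dif_refl.
    apply: npq; apply/cellP; split; first by rewrite -qe.
    rewrite qe in pm mw; move/cellP: pw => -[_]; rewrite (dif_cat pm mw).
    by case: (dif p q).
  move/cellP: qw => -[_]; rewrite (dif_cat qm mw).
  by case: (dif q m) d0 => //= f s _; rewrite take0 mem_head.
exists [::]; apply/seteqP; split=> // w [/sub_cell0 qw /sub_cell0 pw].
by apply: n; exists w.
Qed.

Lemma cell_nbhs p A q : cell p A q -> cell q A `<=` cell p A.
Proof.
move=> /cellP[pq hq] u /cellP[qu hu]; apply/cellP; split.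
  exact: cell_trans qu.
by rewrite (dif_cat pq qu); case: (dif p q) hq.
Qed.

Lemma cell_catl p A C : cell p (A ++ C) = cell p A `&` cell p C.
Proof.
have hU s : starts_in (A ++ C) s = starts_in A s || starts_in C s.
  by case: s => //= f s; rewrite mem_cat.
apply/seteqP; split=> u.
  by rewrite cellP hU negb_or => -[pu /andP[a c]]; split; apply/cellP.
by case=> /cellP[pu a] /cellP[_ c]; apply/cellP; rewrite hU negb_or a.
Qed.

Lemma cell_step p f : org f = pter p -> epos f ->
  cell p [::] (pmul p (epath f)) /\ dif p (pmul p (epath f)) = [:: f].
Proof.
move=> fp pf; have pe : pter p = porg (epath f) by [].
have d : dif p (pmul p (epath f)) = [:: f] by rewrite /dif pmulVK.
by split=> //; apply/cell0P; rewrite d /= pf porg_pmul.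
Qed.

Lemma dif_org p u f s : porg p = porg u -> dif p u = f :: s -> org f = pter p.
Proof.
move=> pu d; have /= := rpath_walk (pmul (pinv p) u).
rewrite -/(dif p u) d /= => /andP[/eqP -> _].
by rewrite porg_pmul ?porg_pinv ?pter_pinv.
Qed.

(** Since [A] is a finite list, this covers [cell p [::]] by finitely many cells, which is the form
    that [primefilter_step] uses. *)
Lemma cell_cover p A u : cell p [::] u -> cell p A u \/
  exists f, [/\ f \in A, org f = pter p, epos f &
    cell (pmul p (epath f)) [::] u].
Proof.
move=> pu; have [|h] := boolP (starts_in A (dif p u)); last first.
  by left; apply/cellP.
case d : (dif p u) => [|f s] //= fA; right; exists f.
have fp := dif_org (esym (cell_porg pu)) d.
have pf : epos f by have /cell0P[_] := pu; rewrite d => /andP[].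
split=> //; have [pm dm] := cell_step fp pf.
by apply: cell_prefix pm pu _; rewrite dm d /= eqxx prefix0s.
Qed.

End Cells.

(** * Cells as the basic sets of the forest *)

Section ForestCells.
Variable E : digraph.
Local Notation Et := (forest_of E).
Implicit Types (e f : edge E) (s t A : seq (edge E)) (p q u m w : rpath E).
Implicit Types a : edge Et.

Lemma is_cedge_step p f : pter p = org f -> is_cedge (p, pmul p (epath f)).
Proof.
by move=> pf; rewrite /is_cedge /= porg_pmul // eqxx /plen pmulVK.
Qed.

Definition step_edge p f (pf : pter p = org f) : edge Et :=
  CEdge (is_cedge_step pf).

Definition elabel a : seq (edge E) := dif (org a) (ter a).

Lemma elabel_step p f (pf : pter p = org f) : elabel (step_edge pf) = [:: f].
Proof. by rewrite /elabel /dif /= pmulVK. Qed.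

Lemma epos_step p f (pf : pter p = org f) : epos f -> cepos (step_edge pf).
Proof. by move=> ef; rewrite /cepos /= pmulVK //= ef. Qed.

Lemma elabelP a : exists f, elabel a = [:: f] /\ epos a = epos f.
Proof.
case: a => -[p q] /= /[dup] /andP[/= /eqP pq]; rewrite /elabel /cepos /dif /=.
rewrite /epos /= /cepos /plen /=.
by case: (pseq _) => [|f [|]] //= _ _; exists f; rewrite andbT.
Qed.

Lemma edge_porg a : porg (org a : rpath E) = porg (ter a : rpath E).
Proof. by case: a => -[p q] /= /andP[/= /eqP]. Qed.

Lemma edge_eq a b : org a = org b -> elabel a = elabel b -> a = b.
Proof.
move=> ab lab; apply: val_inj; case: a b ab lab => -[p q] pq [[p' q'] pq'] /=.
move=> pp; rewrite /elabel /= -pp => dd; congr pair.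
have /andP[/= /eqP h _] := pq; have /andP[/= /eqP h' _] := pq'.
by apply: (dif_inj h) dd; rewrite pp.
Qed.

Lemma pos_edge_cell a : epos a -> cell (org a) [::] (ter a).
Proof.
have [f [lf ->]] := elabelP a => pf; apply/cell0P; split.
  by rewrite edge_porg.
by rewrite -/(elabel a) lf /= pf.
Qed.

Lemma reachE p : @reach Et p = cell p [::].
Proof.
apply/seteqP; split=> u.
  move=> [c [dc <- <-]]; move: (rpath_walk c) dc; rewrite /directed.
  elim: (pseq c) (porg c) => [|a s IHs] v /=.
    by move=> /eqP-> _; apply: cell_refl.
  move=> /andP[/eqP <- ws] /andP[pa ps]; apply: cell_trans (IHs _ ws ps).
  exact: pos_edge_cell.
move=> pu; suff [s [ws ps]] :
    exists s : seq (edge Et), walk (p : vert Et) s u /\ all (@epos Et) s.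
  have rs : is_rpath (p : vert Et, s).
    by rewrite is_rpathE (walk_last ws) ws positive_reduced.
  by exists (RPath rs); split=> //; apply: walk_last ws.
have [n] := ubnP (size (dif p u)); elim: n p pu => // n IHn p pu.
have up := esym (cell_porg pu).
case d : (dif p u) => [|f s] sn.
  exists [::]; split=> //=; apply/eqP/(dif_inj _ up) => //.
  by rewrite dif_refl d.
have fp := dif_org up d; have pf : epos f.
  by have /cell0P[_] := pu; rewrite d => /andP[].
have [pm dm] := cell_step fp pf.
have mu : cell (pmul p (epath f)) [::] u.
  by apply: cell_prefix pm pu _; rewrite dm d /= eqxx prefix0s.
have [|t [wt pt]] := IHn _ mu.
  by move: d; rewrite (dif_cat pm mu) dm => -[->].
exists (step_edge (esym fp) :: t); rewrite /= eqxx wt pt andbT; split=> //.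
by rewrite epos_step.
Qed.

Lemma reachDE p (F : set (edge Et)) A :
  (forall a, @Delta1 Et p a ->
    F a <-> exists2 f, f \in A & elabel a = [:: f]) ->
  @reachD Et p F = cell p A.
Proof.
move=> FA; apply/seteqP; split=> u.
  move=> [->|[a [[pa ap] nFa]]]; first exact: cell_refl.
  rewrite reachE => au; apply/cellP; have pm := pos_edge_cell pa.
  rewrite ap in pm; split; first exact: cell_trans au.
  have [f [lf _]] := elabelP a; rewrite (dif_cat pm au) -[in dif p _]ap.
  rewrite -/(elabel a) lf /=; apply/negP => fA; apply: nFa.
  by apply/FA => //; exists f.
move=> /cellP[pu nA]; have up := esym (cell_porg pu).
case d : (dif p u) nA => [|f s] /= fA.
  by left; apply: (dif_inj up) => //; rewrite dif_refl.
right; have fp := dif_org up d; have pf : epos f.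
  by have /cell0P[_] := pu; rewrite d => /andP[].
have [pm dm] := cell_step fp pf.
have mu : cell (pmul p (epath f)) [::] u.
  by apply: cell_prefix pm pu _; rewrite dm d /= eqxx prefix0s.
have D1 : @Delta1 Et p (step_edge (esym fp)).
  by split=> //; apply: epos_step.
exists (step_edge (esym fp)); last by rewrite reachE.
split=> // /(FA _ D1)[g gA]; rewrite elabel_step => -[fg].
by rewrite -fg (negPf fA) in gA.
Qed.

(** A forest edge is determined by its origin and its label, so finite sets of edges issuing from
    [p] amount to finite lists of labels. *)
Lemma basicP (B : set (vert Et)) :
  basic B <-> exists (p : rpath E) A, B = cell p A.
Proof.
split=> [[p [F [finF FD ->]]]|[p [A ->]]].
  have /finite_seqP[s Fs] := finF.
  exists p, (flatten [seq elabel a | a <- s]); apply: reachDE => a [pa ap].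
  split=> [|[f /flattenP[_ /mapP[b bs ->]] fb af]].
    rewrite Fs /= => as_; have [f [lf _]] := elabelP a; exists f => //.
    by apply/flattenP; exists (elabel a); rewrite ?map_f // lf mem_head.
  have Fb : F b by rewrite Fs.
  suff -> : a = b by [].
  apply: edge_eq; first by rewrite ap; have [] := FD _ Fb.
  have [g [lg _]] := elabelP b; rewrite af lg; move: fb; rewrite lg inE.
  by move=> /eqP->.
pose F := @Delta1 Et p `&` (elabel @^-1` [set` [seq [:: f] | f <- A]]).
exists p, F; split=> [|a []//|].
  pose lab' a := (org a, elabel a).
  apply: (@sub_finite_set _ _ (lab' @^-1`
      [set` [seq (p, [:: f]) | f <- A]])).
    move=> a [[_ ap]] /= /mapP[f fA lf]; apply/mapP; exists f => //.
    by rewrite /lab' ap lf.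
  apply: finite_preimage; last by apply/finite_seqP; eexists.
  by move=> a b _ _ [ab lab]; apply: edge_eq.
apply/esym/reachDE => a Da; split.
  by move=> [_ /= /mapP[f fA lf]]; exists f.
by move=> [f fA lf]; split=> //=; apply/mapP; exists f.
Qed.

Lemma idirected_cell (w : nat -> edge Et) i j : idirected w -> i <= j ->
  cell (org (w i)) [::] (org (w j)) /\
  size (dif (org (w i)) (org (w j))) = j - i.
Proof.
move=> [wp we] /subnK <-; elim: (j - i) => [|k [IHc IHs]].
  by rewrite add0n dif_refl subnn; split=> //; apply: cell_refl.
have <- : ter (w (k + i)) = org (w (k.+1 + i)).
  by have /andP[/eqP] := wp (k + i).
have pc := pos_edge_cell (we (k + i)).
split; first exact: cell_trans pc.
have [f [lf _]] := elabelP (w (k + i)).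
rewrite (dif_cat IHc pc) size_cat IHs -/(elabel (w (k + i))) lf /= !addnK.
by rewrite addn1.
Qed.

(** Suppose that [cell p A] meets every cell along [w]. Then the turning point [m] of [org (w 0)]
    and [p] lies on [w], and far enough beyond [m] the first label from [p] is constant, so a whole
    cell along [w] is included. *)
Lemma end_cell_decide (w : nat -> edge Et) p A : idirected w ->
  exists j, cell (org (w j)) [::] `<=` cell p A \/
            cell (org (w j)) [::] `&` cell p A = set0.
Proof.
move=> wd; apply: contrapT => nex.
have meet j : exists u, cell (org (w j)) [::] u /\ cell p A u.
  apply: contrapT => nu; apply: nex; exists j; right.
  by apply/seteqP; split=> // u [? ?]; apply: nu; exists u.
pose q i : rpath E := org (w i).
have [u0 [q0u0 pu0]] := meet 0.
have [m [q0m pm H]] := cell_meet q0u0 (sub_cell0 pu0).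
(* One more than the distance from [q 0] to [m], so that [q j] lies strictly below [m] and
   [dif p (q j)] is not empty. *)
pose j := (size (dif (q 0) m)).+1; have [u [qu pu]] := meet j.
have [q0q sq] := @idirected_cell w 0 j wd isT.
have q0u := cell_trans q0q qu; have mu := H u q0u (sub_cell0 pu).
have pre : prefix (dif (q 0) m) (dif (q 0) (q j)).
  have := dif_cat q0q qu; rewrite (dif_cat q0m mu) => /(congr1 (take j.-1)).
  rewrite take_size_cat // takel_cat; last by rewrite -/(q 0) -/(q j) sq subn0.
  by move=> ->; apply: prefix_take.
have mq := cell_prefix q0m q0q pre.
have pq := cell_trans pm mq.
have nz : dif p (q j) != [::].
  rewrite (dif_cat pm mq) -size_eq0 size_cat addn_eq0 negb_and orbC.
  move: sq; rewrite -/(q 0) -/(q j) (dif_cat q0m mq) size_cat subn0.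
  by case: (size (dif m (q j))) => //; rewrite addn0 /j => /n_Sn.
apply: nex; exists j; left => v qv.
move/cellP: pu => [_]; rewrite (dif_cat pq qu) starts_in_cat // => nA.
apply/cellP; split; first exact: cell_trans qv.
by rewrite (dif_cat pq qv) starts_in_cat.
Qed.

End ForestCells.

(** * The ring of sets and its ultrafilters *)

Section SetRing.
Variable T : digraph.
Implicit Types (B C V : set (vert T)).

Lemma ringA0 : @setringA T set0.
Proof.
exists 0, (fun=> set0); split=> [[]//|[]//|].
by apply/seteqP; split=> // u [[]].
Qed.

Lemma ringA_add B V : setringA B -> basic V -> B `&` V = set0 ->
  setringA (B `|` V).
Proof.
move=> [n [W [bW tW ->]]] bV BV0.
pose W' (i : 'I_n.+1) := if unlift ord_max i is Some j then W j else V.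
have dis j u : W j u -> V u -> False.
  move=> Wu Vu; suff: (set0 : set (vert T)) u by [].
  by rewrite -BV0; split=> //; exists j.
exists n.+1, W'; split=> [i|i j _ _|].
- by rewrite /W'; case: unliftP.
- rewrite /W'; case: unliftP => [k ->|->]; case: unliftP => [l ->|->] //.
  + by move=> kl; congr lift; apply: tW kl.
  + by case=> u [Wu Vu]; case: (dis _ _ Wu Vu).
  + by case=> u [Vu Wu]; case: (dis _ _ Wu Vu).
apply/seteqP; split=> u.
  case=> [[j _ Wj]|Vu]; last by exists ord_max => //; rewrite /W' unlift_none.
  by exists (lift ord_max j) => //; rewrite /W' liftK.
case=> i _; rewrite /W'; case: unliftP => [j _ Wu|_ Vu]; last by right.
by left; exists j.
Qed.

Lemma ringA_ind (P : set (vert T) -> Prop) : P set0 ->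
  (forall B V, setringA B -> P B -> basic V -> B `&` V = set0 ->
    P (B `|` V)) ->
  forall B, setringA B -> P B.
Proof.
move=> P0 PU B [n [W [bW tW ->]]].
elim: n W bW tW => [|n IHn] W bW tW.
  by have -> : \bigcup_i W i = set0 by apply/seteqP; split=> // u [[]].
pose W' j := W (lift ord_max j).
have tW' : trivIset setT W'.
  by move=> i j _ _ /tW => /(_ I I) /lift_inj.
have bW' i : basic (W' i) by apply: bW.
have -> : \bigcup_i W i = \bigcup_i W' i `|` W ord_max.
  apply/seteqP; split=> u.
    case=> i _; case: (unliftP ord_max i) => [j ->|->] Wu; last by right.
    by left; exists j.
  by case=> [[j _ Wu]|Wu]; [exists (lift ord_max j) | exists ord_max].
apply: (PU _ _ _ (IHn _ bW' tW') (bW _)); first by exists n, W'.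
apply/seteqP; split=> // u [[j _ Wj] Wm].
have : lift ord_max j = ord_max by apply: tW => //; exists u.
by move/eqP; rewrite eq_sym (negPf (neq_lift _ _)).
Qed.

Lemma ringA_basic V : basic V -> setringA V.
Proof.
move=> bV; rewrite -[V]set0U; apply: ringA_add => //; first exact: ringA0.
by rewrite set0I.
Qed.

Lemma ringAU B C : setringA B -> setringA C -> B `&` C = set0 ->
  setringA (B `|` C).
Proof.
move=> rB; move: C; apply: ringA_ind => [|C V rC IHC bV CV0 BCV].
  by rewrite setU0.
rewrite setUA; apply: ringA_add => //.
  apply: IHC; apply/seteqP; split=> // u [Bu Cu].
  by rewrite -BCV; split; [|left].
apply/seteqP; split=> // u [[Bu|Cu] Vu]; last by rewrite -CV0.
by rewrite -BCV; split; [|right].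
Qed.

Lemma uf_ultra (x : spec T) : ringultra (ufval x).
Proof. by case: x. Qed.

Lemma ufR (x : spec T) B : ufval x B -> setringA B.
Proof. by have [[sub _ _ _ _] _] := uf_ultra x; apply: sub. Qed.

Lemma uf0 (x : spec T) : ~ ufval x set0.
Proof. by have [[]] := uf_ultra x. Qed.

Lemma ufI (x : spec T) B C : ufval x B -> ufval x C -> ufval x (B `&` C).
Proof. by have [[_ _ _ cap _] _] := uf_ultra x; apply: cap. Qed.

Lemma ufS (x : spec T) B C : ufval x B -> setringA C -> B `<=` C -> ufval x C.
Proof. by have [[_ _ _ _ up] _] := uf_ultra x; apply: up. Qed.

Lemma uf_ex (x : spec T) : ufval x !=set0.
Proof. by have [[]] := uf_ultra x. Qed.

Lemma spec_eq (x y : spec T) : ufval x = ufval y -> x = y.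
Proof.
case: x y => [U hU] [V hV] /= UV; move: hU; rewrite UV => hU.
by congr Spec; apply: Prop_irrelevance.
Qed.

Lemma spec_sub_eq (x y : spec T) : ufval x `<=` ufval y -> x = y.
Proof.
move=> xy; apply/esym/spec_eq; have [_ mx] := uf_ultra x.
by apply: mx => //; have [] := uf_ultra y.
Qed.

End SetRing.

(** * Ultrafilters of the forest: vertices and ends *)

Section ForestSpectrum.
Variable E : digraph.
Local Notation Et := (forest_of E).
Implicit Types (f : edge E) (A : seq (edge E)) (p q u m w : rpath E).
Implicit Types (B C D : set (vert Et)) (U : set (set (vert Et))).
Implicit Types (x y : spec Et).

Lemma ringA_cell p A : setringA (cell p A).
Proof. by apply/ringA_basic/basicP; exists p, A. Qed.

Lemma ringAI B C : setringA B -> setringA C -> setringA (B `&` C).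
Proof.
move=> rB; move: C; apply: ringA_ind => [|C V rC IHC bV CV0].
  by rewrite setI0; apply: ringA0.
rewrite setIUr; apply: ringAU => //; last first.
  by rewrite setIACA CV0 setI0.
move: B rB {IHC}; apply: ringA_ind => [|B W rB IHB bW BW0].
  by rewrite set0I; apply: ringA0.
rewrite setIUl; apply: ringAU => //; last by rewrite setIACA BW0 set0I.
move/basicP: bV => [p [A ->]]; move/basicP: bW => [q [A' ->]].
have [->|[m [A'' ->]]] := cellI q A' p A; first exact: ringA0.
exact: ringA_cell.
Qed.

Lemma ringA_cells B : setringA B -> exists s : seq (rpath E * seq (edge E)),
  B = [set u | exists2 c, c \in s & cell c.1 c.2 u].
Proof.
move: B; apply: ringA_ind => [|B V rB [s ->] /basicP[p [A ->]] _].
  by exists [::]; apply/seteqP; split=> // u [].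
exists ((p, A) :: s); apply/seteqP; split=> u.
  case=> [[c cs cu]|pu]; first by exists c => //; rewrite inE cs orbT.
  by exists (p, A) => //; rewrite mem_head.
case=> c; rewrite inE => /orP[/eqP-> pu|cs cu]; first by right.
by left; exists c.
Qed.

(** The ring need not contain complements, so a member of [U] disjoint from [C] takes their place.
    If there is none, [U] and [C] generate a filter [W], which equals [U] by maximality. *)
Lemma ultra_decide U C : ringultra U -> setringA C ->
  U C \/ exists2 B, U B & B `&` C = set0.
Proof.
move=> [[UR U0 nU Ucap Uup] Umax] rC.
have [h|h] := pselect (exists2 B, U B & B `&` C = set0); first by right.
pose W : set (set (vert Et)) :=
  [set D | setringA D /\ exists2 B, U B & B `&` C `<=` D].
left; have [B0 UB0] := U0; suff -> : U = W.
  by split=> //; exists B0 => // u [].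
apply/esym/Umax.
  split=> [D []//|||D D' [rD [B UB BD]] [rD' [B' UB' BD']]|].
  - by exists B0; split; [apply: UR | exists B0 => // u []].
  - by case=> _ [B UB]; rewrite subset0 => BC; apply: h; exists B.
  - split; first exact: ringAI.
    exists (B `&` B'); first exact: Ucap.
    by move=> u [[Bu B'u] Cu]; split; [apply: BD | apply: BD'].
  - move=> D D' [rD [B UB BD]] rD' DD'; split=> //; exists B => //.
    exact: subset_trans DD'.
by move=> D UD; split; [apply: UR | exists D => // u []].
Qed.

(** Induction over unions: a base element inside one piece is inside the union, and base elements
    missing the two pieces have a common refinement missing both. *)
Lemma base_decide (S : set (set (vert Et))) B : S !=set0 ->
  (forall C D, S C -> S D -> exists2 b, S b & b `<=` C `&` D) ->
  (forall p A, exists2 b, S b & b `<=` cell p A \/ b `&` cell p A = set0) ->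
  setringA B -> exists2 b, S b & b `<=` B \/ b `&` B = set0.
Proof.
move=> [b0 Sb0] Scap Sdec; move: B.
apply: ringA_ind => [|B V rB [b Sb bB] /basicP[p [A ->]] _].
  by exists b0 => //; right; rewrite setI0.
case: bB => [bB|bB]; first by exists b => //; left=> u /bB; left.
have [c Sc [cV|cV]] := Sdec p A; first by exists c => //; left=> u /cV; right.
have [d Sd dbc] := Scap _ _ Sb Sc; exists d => //; right.
apply/seteqP; split=> // u [/dbc[bu cu] [Bu|Vu]].
  by rewrite -bB.
by rewrite -cV.
Qed.

(** A filter containing every base element cannot contain a set missed by one of them, so a base
    that decides all cells generates a maximal filter. Vertices and ends are both treated this
    way. *)
Lemma base_ultra (S : set (set (vert Et))) :
  S `<=` @setringA Et -> S !=set0 -> ~ S set0 ->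
  (forall C D, S C -> S D -> exists2 b, S b & b `<=` C `&` D) ->
  (forall p A, exists2 b, S b & b `<=` cell p A \/ b `&` cell p A = set0) ->
  ringultra [set B | setringA B /\ exists2 b, S b & b `<=` B].
Proof.
move=> SR Sne S0 Scap Sdec; split.
  split=> [B []//|||B C [rB [b Sb bB]] [rC [c Sc cC]]|].
  - by have [b Sb] := Sne; exists b; split; [apply: SR | exists b].
  - by case=> _ [b Sb]; rewrite subset0 => b0; apply: S0; rewrite -b0.
  - split; first exact: ringAI.
    have [d Sd dbc] := Scap _ _ Sb Sc; exists d => //.
    by move=> u /dbc[bu cu]; split; [apply: bB | apply: cC].
  - by move=> B C [rB [b Sb bB]] rC BC; split=> //; exists b => // u /bB /BC.
move=> U [UR _ U0 Ucap Uup] SU; apply/seteqP; split=> // B UB.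
have rB := UR _ UB; have [b Sb [bB|bB]] := base_decide Sne Scap Sdec rB.
  by split=> //; exists b.
exfalso; apply: U0; rewrite -bB; apply: Ucap => //.
by apply: SU; split; [apply: SR | exists b].
Qed.

Lemma vert_base q :
  let S := [set cell q A | A in setT] in
  [/\ S !=set0,
    forall C D, S C -> S D -> exists2 b, S b & b `<=` C `&` D &
    forall p A, exists2 b, S b & b `<=` cell p A \/ b `&` cell p A = set0].
Proof.
split=> [|_ _ [A _ <-] [A' _ <-]|p A]; first by exists (cell q [::]), [::].
  by exists (cell q (A ++ A')); [exists (A ++ A') | rewrite cell_catl].
have [pq|npq] := pselect (cell p A q).
  by exists (cell q A); [exists A | left; apply: cell_nbhs].
by have [C qC] := cell_sep npq; exists (cell q C); [exists C | right].
Qed.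

Lemma ringA_nbhs q B : setringA B -> B q -> exists A, cell q A `<=` B.
Proof.
move=> rB Bq; have [Sne Scap Sdec] := vert_base q.
have [_ [A _ <-] [AB|AB]] := base_decide Sne Scap Sdec rB; first by exists A.
have : (set0 : set (vert Et)) q by rewrite -AB; split=> //; apply: cell_refl.
by [].
Qed.

Lemma vert_uf_ultra q : ringultra (@vert_uf Et q).
Proof.
have [Sne Scap Sdec] := vert_base q; have := base_ultra _ Sne _ Scap Sdec.
set W := (X in ringultra X); suff -> : @vert_uf Et q = W.
  apply=> [_ [A _ <-]|[A _ qA]]; first exact: ringA_cell.
  by have := cell_refl q A; rewrite qA.
apply/seteqP; split=> B.
  move=> [rB Bq]; split=> //; have [A AB] := ringA_nbhs rB Bq.
  by exists (cell q A) => //; exists A.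
by move=> [rB [_ [A _ <-] AB]]; split=> //; apply/AB/cell_refl.
Qed.

Lemma end_uf_ultra (w : nat -> edge Et) : idirected w -> ringultra (end_uf w).
Proof.
move=> wd; pose S := [set cell (org (w j)) [::] | j in [set: nat]].
have le i j : i <= j -> cell (org (w j)) [::] `<=` cell (org (w i)) [::].
  by move=> ij u; apply: cell_trans; have [] := idirected_cell wd ij.
have Sne : S !=set0 by exists (cell (org (w 0)) [::]), 0.
have Scap C D : S C -> S D -> exists2 b, S b & b `<=` C `&` D.
  move=> [i _ <-] [j _ <-]; exists (cell (org (w (maxn i j))) [::]).
    by exists (maxn i j).
  by move=> u cu; split; apply: le cu; rewrite ?leq_maxl ?leq_maxr.
have Sdec p A : exists2 b, S b & b `<=` cell p A \/ b `&` cell p A = set0.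
  have [j hj] := end_cell_decide p A wd.
  by exists (cell (org (w j)) [::]) => //; exists j.
have := base_ultra _ Sne _ Scap Sdec.
set W := (X in ringultra X); suff -> : end_uf w = W.
  apply=> [_ [j _ <-]|[j _ qA]]; first exact: ringA_cell.
  by have := cell_refl (org (w j)) [::]; rewrite qA.
apply/seteqP; split=> B [rB].
  move=> [j jB]; split=> //; exists (cell (org (w j)) [::]); first by exists j.
  by rewrite -reachE.
by move=> [_ [j _ <-] jB]; split=> //; exists j; rewrite reachE.
Qed.

Definition cells (s : seq (rpath E * seq (edge E))) : set (vert Et) :=
  [set u | exists2 c, c \in s & cell c.1 c.2 u].

(** Unlike maximality, this property can be checked directly for limits of ultrafilters in
    [compact_uf]; [primefilter_point] shows that it suffices. *)
Definition primefilter U :=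
  ringfilter U /\ forall s B, U B -> B `<=` cells s ->
    exists2 c, c \in s & U (cell c.1 c.2).

Lemma ultra_prime U : ringultra U -> primefilter U.
Proof.
move=> Uu; have [[UR _ U0 Ucap _] _] := Uu; split; first by case: Uu.
elim=> [|c s IHs] B UB Bs.
  by case: U0; suff <- : B = set0 by []; apply/seteqP; split=> // u /Bs[].
have [Uc|[C UC Cc]] := ultra_decide Uu (ringA_cell c.1 c.2).
  by exists c; rewrite ?mem_head.
have [|d ds Ud] := IHs (B `&` C) (Ucap _ _ UB UC); last first.
  by exists d; rewrite // inE ds orbT.
move=> u [/Bs[d]]; rewrite inE => /orP[/eqP-> du Cu|ds du _]; last by exists d.
by have : (set0 : set (vert Et)) u by rewrite -Cc.
Qed.

Lemma primefilter_step U q A : primefilter U -> U (cell q [::]) ->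
  U (cell q A) \/
  exists f, [/\ org f = pter q, epos f & U (cell (pmul q (epath f)) [::])].
Proof.
move=> [_ Up] Uq.
pose s := [seq f <- A | (org f == pter q) && epos f].
have [|c] := Up ((q, A) :: [seq (pmul q (epath f), [::]) | f <- s]) _ Uq.
  move=> u /(cell_cover A)[qu|[f [fA fq pf fu]]].
    by exists (q, A); rewrite ?mem_head.
  exists (pmul q (epath f), [::]) => //; rewrite inE; apply/orP; right.
  by apply/mapP; exists f => //; rewrite mem_filter fq eqxx pf.
rewrite inE => /orP[/eqP->|]; first by left.
case/mapP=> f; rewrite mem_filter => /andP[/andP[/eqP fq pf] _] -> Uf.
by right; exists f.
Qed.

(** Descend along directed edges through cells that belong to [U]. If some [q] has no child whose
    cell is in [U], then [U] is the filter of [q]; otherwise the descent gives an infinite directed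
    path whose end is [U]. *)
Lemma primefilter_point U : primefilter U ->
  exists x : spec Et, ufval x = U /\
    ((exists q, U = @vert_uf Et q) \/ exists2 w, idirected w & U = end_uf w).
Proof.
move=> Up; have [[UR [B0 UB0] U0 Ucap Uup] Upr] := Up.
(* Vertex and end filters are maximal, so their inclusion in [U] gives equality. *)
have Umax V : ringultra V -> V `<=` U -> U = V by move=> [_]; apply; case: Up.
have [p Up0] : exists p, U (cell p [::]).
  have [s Bs] := ringA_cells (UR _ UB0).
  have [|c cs Uc] := Upr s _ UB0; first by rewrite [X in X `<=` _]Bs.
  by exists c.1; apply: Uup Uc _ _; [apply: ringA_cell | apply: sub_cell0].
have [[q [Uq nq]]|H] := pselect (exists q, U (cell q [::]) /\
    forall f, org f = pter q -> epos f -> ~ U (cell (pmul q (epath f)) [::])).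
  have Uv : U = @vert_uf Et q.
    apply: Umax (vert_uf_ultra q) _ => B [rB Bq].
    have [A AB] := ringA_nbhs rB Bq; apply: Uup rB AB.
    have [//|[f [fq pf Uf]]] := primefilter_step A Up Uq.
    by case: (nq f).
  have Uu : ringultra U by rewrite Uv; apply: vert_uf_ultra.
  by exists (Spec Uu); split=> //; left; exists q.
(* Dependent choice: each state carries the proof that its cell is in [U]. *)
have next (a : {q | U (cell q [::])}) : exists f,
    [/\ pter (sval a) = org f, epos f &
      U (cell (pmul (sval a) (epath f)) [::])].
  case: a => q Uq /=; apply: contrapT => nf; apply: H; exists q; split=> //.
  by move=> f fq pf Uf; apply: nf; exists f.
pose F a := projT1 (cid (next a)).
have FP a : [/\ pter (sval a) = org (F a), epos (F a) &
    U (cell (pmul (sval a) (epath (F a))) [::])].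
  by rewrite /F; case: cid.
pose nx (a : {q | U (cell q [::])}) : {q | U (cell q [::])} :=
  let: And3 _ _ h := FP a in exist _ _ h.
have nxE a : sval (nx a) = pmul (sval a) (epath (F a)).
  by rewrite /nx; case: (FP a).
pose a i := iter i nx (exist _ p Up0).
have aF i : pter (sval (a i)) = org (F (a i)) by case: (FP (a i)).
pose w i : edge Et := step_edge (aF i).
have wd : idirected w.
  have pw i : epos (w i) by apply: epos_step; case: (FP (a i)).
  split=> // i; apply/andP; split; first by rewrite /= -nxE.
  by apply: contraTneq (pw i.+1) => ->; rewrite epos_ebar pw.
have Uw : U = end_uf w.
  apply: Umax (end_uf_ultra wd) _ => B [rB [j jB]].
  by apply: Uup rB jB; rewrite reachE; apply: (svalP (a j)).
have Uu : ringultra U by rewrite Uw; apply: end_uf_ultra.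
by exists (Spec Uu); split=> //; right; exists w.
Qed.

Lemma spec_point x :
  (exists q, ufval x = @vert_uf Et q) \/
  exists2 w, idirected w & ufval x = end_uf w.
Proof.
by have [y [<-]] := primefilter_point (ultra_prime (uf_ultra x)).
Qed.

End ForestSpectrum.

(** * The spectrum as a space of filters on finite paths *)

Section Eventually.
Variable E : digraph.
Local Notation Et := (forest_of E).
Implicit Types (f : edge E) (s A : seq (edge E)) (p q u : rpath E).
Implicit Types (B C : set (vert Et)) (x y : spec Et) (P Q : set (rpath E)).

(* [x] as a filter on [E^*].  For an end, [P] has to contain a whole set [V(q)]
   and not just a tail of a path; for a vertex [q], [[set q]] need not be a
   member. *)
Definition evt x P : Prop := exists2 B, ufval x B & B `<=` P.

Lemma evtI x P Q : evt x P -> evt x Q -> evt x (P `&` Q).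
Proof.
move=> [B xB BP] [C xC CQ]; exists (B `&` C); first exact: ufI.
by move=> q [/BP ? /CQ].
Qed.

Lemma evtS x P Q : P `<=` Q -> evt x P -> evt x Q.
Proof. by move=> PQ [B xB BP]; exists B => // q /BP /PQ. Qed.

Lemma evt_ex x P : evt x P -> exists q, P q.
Proof.
move=> [B xB BP]; apply: contrapT => nP; apply: (@uf0 _ x).
suff <- : B = set0 by []; apply/seteqP; split=> // q /BP Pq.
by apply: nP; exists q.
Qed.

Lemma evtT x : evt x setT.
Proof. by have [B xB] := uf_ex x; exists B. Qed.

Lemma evt_ring x B : setringA B -> evt x B -> ufval x B.
Proof. by move=> rB [C xC CB]; apply: ufS xC rB CB. Qed.

Lemma uf_evt x B : ufval x B -> evt x B.
Proof. by move=> xB; exists B. Qed.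

Lemma spec_evt_eq x y : (forall P, evt x P -> evt y P) -> x = y.
Proof.
move=> xy; apply: spec_sub_eq => B xB.
by apply: evt_ring (ufR xB) (xy _ (uf_evt xB)).
Qed.

(** * The topology of the spectrum *)

Lemma open_uf B : setringA B -> open [set x : spec Et | ufval x B].
Proof.
move=> rB; rewrite /open /=.
exists [set [set x : spec Et | ufval x B]]; last first.
  apply/seteqP; split=> x; first by case=> _ ->.
  by move=> xB; exists [set x | ufval x B].
by move=> _ ->; apply: finI_from1.
Qed.

Lemma open_evt P : open [set x | evt x P].
Proof.
have -> : [set x | evt x P] =
    \bigcup_(B in [set B : set (vert Et) | setringA B /\ B `<=` P])
      [set x | ufval x B].
  apply/seteqP; split=> x; first by case=> B xB BP; exists B => //; split=> //;
    apply: ufR xB.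
  by case=> B [rB BP] xB; exists B.
by apply: bigcup_open => B [rB _]; apply: open_uf.
Qed.

(** Ultrafilters are nonempty and closed under finite intersections, so the subbase already acts as
    a base. *)
Lemma nbhs_spec x (O : set (spec Et)) :
  nbhs x O <-> exists2 B, ufval x B & forall y, ufval y B -> O y.
Proof.
rewrite nbhsE; split=> [[V [oV Vx] VO]|[B xB BO]]; last first.
  exists [set y | ufval y B] => //; split=> //.
  exact/open_uf/(ufR xB).
have [D' D'f VE] : exists2 D' : set (set (spec Et)),
    D' `<=` finI_from (@setringA Et) (fun B => [set x : spec Et | ufval x B]) &
    \bigcup_(W in D') W = V.
  by case: oV => D' D'f VE; exists D'.
move: Vx; rewrite -VE => -[W D'W Wx].
have [M MD WE] := D'f _ D'W.
pose MS : seq (set (vert Et)) := finmap.enum_fset M.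
suff [B xB BM] : exists2 B, ufval x B & forall i, i \in MS -> B `<=` i.
  exists B => // y yB; apply: VO; rewrite -VE; exists W => //.
  rewrite -WE => i iM; apply: ufS yB _ (BM i iM).
  by have := MD i iM; rewrite inE.
have : forall i, i \in MS -> ufval x i.
  by move=> i iM; move: Wx; rewrite -WE; apply.
elim: MS => [|i s IHs] xi.
  by have [B xB] := uf_ex x; exists B.
have [|B xB Bs] := IHs; first by move=> j js; apply: xi; rewrite inE js orbT.
exists (i `&` B); first by apply: ufI => //; apply: xi; rewrite mem_head.
by move=> j; rewrite inE => /orP[/eqP->|/Bs Bj] u [] // _ /Bj.
Qed.

Lemma spec_separate x y : x != y ->
  exists B C, [/\ ufval x B, ufval y C & B `&` C = set0].
Proof.
move=> xy; have [B xB nyB] : exists2 B, ufval x B & ~ ufval y B.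
  apply: contrapT => H; move/eqP: xy; apply; apply: spec_sub_eq => B xB.
  by apply: contrapT => nyB; apply: H; exists B.
have [//|[C yC CB]] := ultra_decide (uf_ultra y) (ufR xB).
by exists B, C; rewrite setIC.
Qed.

Lemma spec_hausdorff : hausdorff_space (spec Et).
Proof.
move=> x y cxy; apply/eqP; rewrite -[_ == _]negbK; apply/negP => xy.
have [B [C [xB yC BC]]] := spec_separate xy.
have nB : nbhs x [set z | ufval z B] by apply/nbhs_spec; exists B.
have nC : nbhs y [set z | ufval z C] by apply/nbhs_spec; exists C.
have [z [zB zC]] := cxy _ _ nB nC.
by apply: (@uf0 _ z); rewrite -BC; apply: ufI.
Qed.

Lemma evt_decide_closed P : (forall x, evt x P \/ evt x (~` P)) ->
  closed [set x | evt x P].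
Proof.
move=> dP; rewrite -[X in closed X]setCK; apply: open_closedC.
have -> : ~` [set x | evt x P] = [set x | evt x (~` P)]; last exact: open_evt.
apply/seteqP; split=> x /=; first by have [] := dP x.
by move=> nP xP; have [q []] := evt_ex (evtI xP nP).
Qed.

Lemma closed_uf B : setringA B -> closed [set x : spec Et | ufval x B].
Proof.
move=> rB; have -> : [set x : spec Et | ufval x B] = [set x | evt x B].
  by apply/seteqP; split=> x; [apply: uf_evt | apply: evt_ring].
apply: evt_decide_closed => x.
have [xB|[C xC CB]] := ultra_decide (uf_ultra x) rB.
  by left; apply: uf_evt.
right; exists C => // u Cu Bu; have : (set0 : set (vert Et)) u by rewrite -CB.
by [].
Qed.

(** An ultrafilter [F] on the points induces the filter [U] of those ring members whose points form
    a member of [F]. It is prime because [F] is an ultrafilter, and the point that it defines is a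
    limit of [F]. *)
Lemma compact_uf B : setringA B -> compact [set x : spec Et | ufval x B].
Proof.
move=> rB; rewrite compact_ultra => F FU FB.
pose U : set (set (vert Et)) :=
  [set C | setringA C /\ F [set x : spec Et | ufval x C]].
have UI C D : U C -> U D -> U (C `&` D).
  move=> [rC FC] [rD FD]; split; first exact: ringAI.
  by apply: filterS (filterI FC FD) => x [xC xD]; apply: ufI.
have U0 : ~ U set0 by case=> _ /filter_ex[x]; apply: uf0.
have Up : primefilter U.
  split.
    split=> [C []//||//|//|C D [rC FC] rD CD]; first by exists B.
    by split=> //; apply: filterS FC => x xC; apply: ufS xC rD CD.
  move=> s C [_ FC] Cs.
  have Fs : F [set x : spec Et | exists2 c, c \in s & ufval x (cell c.1 c.2)].
    apply: filterS FC => x xC.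
    by have [_ h] := ultra_prime (uf_ultra x); apply: h xC Cs.
  elim: s Fs {Cs} => [|c s IHs] Fs.
    by have /filter_ex[x []] := Fs.
  have [Fc|nFc] :=
    in_ultra_setVsetC [set x : spec Et | ufval x (cell c.1 c.2)] FU.
    by exists c; rewrite ?mem_head //; split=> //; apply: ringA_cell.
  have [|d ds Ud] := IHs; last by exists d; rewrite // inE ds orbT.
  apply: filterS (filterI Fs nFc) => x [[d]].
  by rewrite inE => /orP[/eqP->//|ds xd _]; exists d.
have [x [xU _]] := primefilter_point Up.
exists x; split; first by rewrite /= xU.
by move=> O /nbhs_spec[C]; rewrite xU => -[_ FC] CO; apply: filterS FC.
Qed.

(** * Initial segments of the words along a point *)

Lemma reduced_cat s t : reduced s -> reduced t ->
  ~~ starts_in (map (@ebar E) s) t -> reduced (s ++ t).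
Proof.
elim: s => // e s IHs rs rt; case: s IHs rs => [_ _|f s IHs].
  by case: t rt => //= f t rt; rewrite inE => ->.
rewrite /reduced /= => /andP[-> rs] h; apply: IHs => //.
by apply: contra h; case: t {rt} => //= g t gs; rewrite inE gs orbT.
Qed.

(** Excluding the reverses of the edges of [q] keeps the first letter of [dif q u] from cancelling
    against the end of [q]. *)
Lemma cell_pseq q A u : {subset map (@ebar E) (pseq q) <= A} -> cell q A u ->
  pseq u = pseq q ++ dif q u.
Proof.
move=> sA [uq pu hu]; rewrite (pseq_dif (esym uq)) reduce_id //.
apply: reduced_cat; [exact: rpath_reduced | exact: positive_reduced |].
by apply: contra hu; case: (dif q u) => //= f s; apply: sA.
Qed.

(** The words along a directed path may at first shrink by cancellation. Once a positive edge has
    been appended, later positive edges cannot cancel against it, and all further words extend the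
    one reached. *)
Lemma end_stable (w : nat -> edge Et) : idirected w -> exists j, forall u,
  cell (org (w j)) [::] u -> pseq u = pseq (org (w j)) ++ dif (org (w j)) u.
Proof.
move=> wd; pose q j : rpath E := org (w j).
suff [j [f ef]] : exists j f, pseq (q j.+1) = pseq (q j) ++ [:: f] /\
    dif (q j) (q j.+1) = [:: f].
  exists j.+1 => u qu; have [qq _] := idirected_cell wd (leqnSn j).
  have /cell0P[uq pu] := qu; rewrite -/(q _) in qu uq pu qq *.
  rewrite (pseq_dif (esym uq)) reduce_id // ef.1.
  have := cell_trans qq qu => /cell0P[_]; rewrite (dif_cat qq qu) ef.2.
  move=> /positive_reduced; have := rpath_reduced (q j.+1); rewrite ef.1.
  rewrite /reduced -catA /=; case: (pseq (q j)) => //= e s.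
  by rewrite !cat_path /= andbT => /andP[-> ->].
(* Each cancelling step shortens the word, so induction on its length finds a step that appends. *)
suff H n : forall j, size (pseq (q j)) <= n ->
    exists j f, pseq (q j.+1) = pseq (q j) ++ [:: f] /\
    dif (q j) (q j.+1) = [:: f] by apply: (H _ 0 (leqnn _)).
have step j : exists f, dif (q j) (q j.+1) = [:: f] /\
    porg (q j) = porg (q j.+1).
  have [f [lf _]] := elabelP (w j); exists f; rewrite -lf.
  have wj : ter (w j) = org (w j.+1) by have [/(_ j)/andP[/eqP]] := wd.
  by rewrite /elabel /q -wj edge_porg.
elim: n => [|n IHn] j; have [f [df qq]] := step j;
    have := pseq_dif qq; rewrite df.
  rewrite leqn0 size_eq0 => e /eqP q0; exists j, f; split=> //.
  by rewrite e q0.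
have [s [c [r [es ec ->]]]] :=
  reduce_cat_split (rpath_reduced (q j)) (isT : reduced [:: f]).
case: c es ec => [|g c] es ec eq sq.
  by exists j, f; split=> //; rewrite eq es ec cats0.
apply: (IHn j.+1); rewrite eq; move: sq; case: c es ec => // es [_ <-].
by rewrite cats0 es size_cat addn1.
Qed.

Lemma evt_prefix x s : evt x [set q | prefix s (pseq q)] \/
  evt x (~` [set q | prefix s (pseq q)]).
Proof.
have [[q xq]|[w wd xw]] := spec_point x.
  (* Excluding the reverses of the edges of [q] makes the words in the cell extend that of [q];
     excluding the letters of [s] keeps them from continuing towards [s]. *)
  pose A := map (@ebar E) (pseq q) ++ s.
  have xA : ufval x (cell q A).
    by rewrite xq; split; [apply: ringA_cell | apply: cell_refl].
  have uE u : cell q A u -> pseq u = pseq q ++ dif q u.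
    by apply: cell_pseq => e eq; rewrite mem_cat eq.
  have [sq|nsq] := boolP (prefix s (pseq q)).
    left; exists (cell q A) => // u /uE /= ->.
    by apply: prefix_trans sq _; apply: prefix_prefix.
  right; exists (cell q A) => // u qu /=; rewrite (uE _ qu).
  move=> /prefixP[t]; have [le|lt] := leqP (size s) (size (pseq q)).
    move=> /(congr1 (take (size s))); rewrite take_size_cat // takel_cat //.
    by move=> e; move: nsq; rewrite prefixE e eqxx.
  move=> e; have := congr1 (drop (size (pseq q))) e.
  rewrite (@drop_size_cat _ _ (pseq q)) // drop_cat lt.
  case: (drop _ s) (mem_drop (n0 := size (pseq q)) (s := s))
    (size_drop (size (pseq q)) s) => [_ /= /esym/eqP|g t' gs _ dE].
    by rewrite subn_eq0 leqNgt lt.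
  have /cellP[_] := qu; rewrite dE /= mem_cat gs ?orbT //.
  by rewrite mem_head.
(* After [size s] steps beyond the stable index, all words agree on their first [size s] letters. *)
have [j0 stab] := end_stable wd; pose j := j0 + size s.
have [jj sj] := idirected_cell wd (leq_addr (size s) j0).
have xj : ufval x (cell (org (w j)) [::]).
  rewrite xw; split; first exact: ringA_cell.
  by exists j; rewrite reachE.
have le : size s <= size (pseq (org (w j))).
  by rewrite (stab _ jj) size_cat sj addKn leq_addl.
have pE u : cell (org (w j)) [::] u ->
    prefix s (pseq u) = prefix s (pseq (org (w j))).
  move=> ju; rewrite (stab u (cell_trans jj ju)) (dif_cat jj ju) catA.
  by rewrite -(stab _ jj) !prefixE takel_cat.
have [sj'|nsj] := boolP (prefix s (pseq (org (w j)))).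
  by left; exists (cell (org (w j)) [::]) => // u /pE /= ->.
by right; exists (cell (org (w j)) [::]) => // u /pE /= ->; apply/negP.
Qed.

Lemma lambdaP x : evt x [set q | porg q = lambda x].
Proof.
rewrite /lambda; case: xgetP => [v _ /= sv|nst]; last first.
  exfalso; have [[q xq]|[w wd xw]] := spec_point x.
    by apply: (nst q); left.
  by apply: (nst (org (w 0))); right; exists w.
exists (cell v [::]); last by move=> u /cell_porg.
case: sv => [->|[w [wd <- ->]]].
  by split; [apply: ringA_cell | apply: cell_refl].
by split; [apply: ringA_cell | exists 0; rewrite reachE].
Qed.

Lemma lambdaE x v : evt x [set q | porg q = v] -> lambda x = v.
Proof. by move=> xv; have [q [<- <-]] := evt_ex (evtI (lambdaP x) xv). Qed.

(** * Left multiplication on the spectrum *)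

Definition pre p P : set (rpath E) :=
  [set q | porg q = pter p /\ P (pmul p q)].

Lemma pre_cell p q A : porg q = porg p ->
  pre p (cell q A) = cell (pmul (pinv p) q) A.
Proof.
move=> qp; have pq : pter (pinv p) = porg q by rewrite pter_pinv.
have d u : porg u = pter p -> dif q (pmul p u) = dif (pmul (pinv p) q) u.
  move=> up; rewrite /dif pinvM // pinvK -pmulA // ?pter_pinv //.
apply/seteqP; split=> u.
  move=> [up [_ pu hu]]; split; rewrite -?d //.
  by rewrite porg_pmul // porg_pinv.
move=> [up pu hu]; have up' : porg u = pter p.
  by rewrite up porg_pmul // porg_pinv.
by split=> //; split; rewrite ?d // porg_pmul.
Qed.

Lemma ringA_pre p B : setringA B -> @setringA Et (pre p B).
Proof.
move: B; apply: ringA_ind => [|B V rB IHB /basicP[q [A ->]] BV0].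
  have -> : pre p set0 = set0 by apply/seteqP; split=> // u [].
  exact: ringA0.
have -> : pre p (B `|` cell q A) = pre p B `|` pre p (cell q A).
  apply/seteqP; split=> u; first by case=> up [|]; [left|right].
  by case=> -[up Bu]; split=> //; [left|right].
apply: ringAU => //; last first.
  apply/seteqP; split=> // u [[_ Bu] [_ qu]].
  suff : (set0 : set (vert Et)) (pmul p u) by [].
  by rewrite -BV0.
have [qp|nqp] := pselect (porg q = porg p).
  by rewrite pre_cell //; apply: ringA_cell.
have -> : pre p (cell q A) = set0; last exact: ringA0.
apply/seteqP; split=> // u [up /cell_porg]; rewrite porg_pmul // => pq.
by apply: nqp.
Qed.

Lemma pre_pre p q P : pter p = porg q -> pre q (pre p P) = pre (pmul p q) P.
Proof.
move=> pq; apply/seteqP; split=> u.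
  by move=> [uq [_ Pu]]; split; rewrite ?pter_pmul // -pmulA.
move=> [+ Pu]; rewrite pter_pmul // => uq; split=> //.
by split; rewrite ?porg_pmul // pmulA.
Qed.

Lemma pre_vpath v P : pre (vpath v) P = [set q | porg q = v] `&` P.
Proof.
by apply/seteqP; split=> u [uv]; rewrite /pre /= pmul1p.
Qed.

(** For maximality: if [B] lies in a larger filter [U] but [pre p B] is not in [x], some [C] in [x]
    misses [pre p B], and the translate [pre (pinv p) C] lies in [U] and misses [B]. *)
Lemma act_ultra p x : pter p = lambda x -> ringultra (act_uf p x).
Proof.
move=> px; have xl : evt x [set q | porg q = pter p].
  by rewrite px; apply: lambdaP.
have evI B : evt x B -> evt x (pre p (pre (pinv p) B)).
  move=> xB; rewrite pre_pre ?pter_pinv // pmulVp pre_vpath; exact: evtI.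
have actP B : setringA B -> evt x (pre p B) -> act_uf p x B.
  by move=> rB xB; split=> //; apply: evt_ring xB; apply: ringA_pre.
split.
  split=> [B []//||[_]|B C [rB xB] [rC xC]|B C [rB xB] rC BC].
  - have [B xB] := uf_ex x; exists (pre (pinv p) B); apply: actP.
      exact/ringA_pre/(ufR xB).
    exact/evI/uf_evt.
  - by move=> /uf_evt/evt_ex[q []].
  - apply: actP; first exact: ringAI.
    apply: evtS (evtI (uf_evt xB) (uf_evt xC)) => q [[qp Bq] [_ Cq]].
    by split.
  - apply: actP => //; apply: evtS (uf_evt xB) => q [qp Bq].
    by split=> //; apply: BC.
move=> U [UR _ U0 Ucap Uup] xU; apply/seteqP; split=> // B UB.
have rB := UR _ UB; have rpB := ringA_pre p rB.
split=> //; have [//|[C xC CB]] := ultra_decide (uf_ultra x) rpB.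
exfalso; apply: U0.
have rC := ringA_pre (pinv p) (ufR xC).
have UC : U (pre (pinv p) C).
  by apply: xU; apply: actP => //; apply/evI/uf_evt.
suff <- : pre (pinv p) C `&` B = set0 by apply: Ucap.
apply/seteqP; split=> // u [[]]; rewrite pter_pinv => up Cu Bu.
suff : (set0 : set (vert Et)) (pmul (pinv p) u) by [].
rewrite -CB; split=> //; split.
  by rewrite porg_pmul ?porg_pinv ?pter_pinv.
by rewrite pmulKV.
Qed.

Lemma ufval_act p x : pter p = lambda x -> ufval (act p x) = act_uf p x.
Proof.
move=> px; rewrite /act; case: pselect => // h; case: h.
exact: act_ultra.
Qed.

(** Reduces statements about the translated point to statements about words along [x], so that the
    action is handled by computing with paths. *)
Lemma evt_act p x P : pter p = lambda x ->
  evt (act p x) P <-> evt x (pre p P).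
Proof.
move=> px; split=> [[B]|[B xB BP]].
  rewrite ufval_act // => -[rB xB] BP; exists (pre p B) => // q [qp Bq].
  by split=> //; apply: BP.
exists (pre (pinv p) B); last first.
  move=> q []; rewrite pter_pinv => qp /BP[_]; rewrite pmulKV //.
rewrite ufval_act //; split; first exact/ringA_pre/(ufR xB).
rewrite -/(pre p _); apply: evt_ring; first exact/ringA_pre/ringA_pre/(ufR xB).
rewrite pre_pre ?pter_pinv // pmulVp pre_vpath; apply: evtI (uf_evt xB).
by rewrite px; apply: lambdaP.
Qed.

Lemma lambda_act p x : pter p = lambda x -> lambda (act p x) = porg p.
Proof.
move=> px; apply: lambdaE; apply/evt_act => //.
apply: evtS (lambdaP x) => q qx; split; first by rewrite px.
by rewrite /= porg_pmul // px.
Qed.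

Lemma act_mul p q x : pter p = porg q -> pter q = lambda x ->
  act p (act q x) = act (pmul p q) x.
Proof.
move=> pq qx; apply: spec_evt_eq => P.
have px : pter p = lambda (act q x) by rewrite lambda_act.
move=> /(evt_act _ px)/(evt_act _ qx); rewrite pre_pre // => h.
by apply/evt_act; rewrite ?pter_pmul.
Qed.

Lemma act_vpath v x : v = lambda x -> act (vpath v) x = x.
Proof.
move=> vx; apply: spec_evt_eq => P; rewrite evt_act // pre_vpath.
exact: evtS.
Qed.

Lemma actVK p x : pter p = lambda x -> act (pinv p) (act p x) = x.
Proof. by move=> px; rewrite act_mul ?pter_pinv // pmulVp act_vpath. Qed.

Lemma actKV p x : porg p = lambda x -> act p (act (pinv p) x) = x.
Proof.
by move=> px; rewrite act_mul ?porg_pinv ?pter_pinv // pmulpV act_vpath.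
Qed.

Lemma act_nbhs p x (O : set (spec Et)) : pter p = lambda x ->
  nbhs (act p x) O -> nbhs x [set y | pter p = lambda y /\ O (act p y)].
Proof.
move=> px /nbhs_spec[B]; rewrite ufval_act // => -[rB xB] BO.
apply/nbhs_spec; exists (pre p B) => // y yB.
have py : pter p = lambda y.
  by apply/esym/lambdaE; apply: evtS (uf_evt yB) => q [].
by split=> //; apply: BO; rewrite ufval_act.
Qed.

Lemma nbhs_lambda x : nbhs x [set y | lambda y = lambda x].
Proof.
have [B xB Bl] := lambdaP x; apply/nbhs_spec; exists B => // y yB.
by apply: lambdaE; exists B.
Qed.

End Eventually.

(** * Infinite paths and cancellation *)

Section Underline.
Variable E : digraph.
Local Notation Et := (forest_of E).
Implicit Types (e f : edge E) (s t : seq (edge E)) (p q b : rpath E).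
Implicit Types (x y : spec Et) (P : set (rpath E)).

(** Whether a nonempty reduced word can be put in front of a reduced word [t] without cancellation
    depends on the first letter of [t] only, which [evt_prefix] decides. *)
Lemma reduced_cat_last s e t :
  reduced (rcons s e ++ t) =
  [&& reduced (rcons s e), reduced t & ~~ prefix [:: ebar e] t].
Proof.
have rt f : sorted (fun e f => f != ebar e) [:: f] by [].
case: t => [|f t]; first by rewrite cats0 /= !andbT.
rewrite /reduced cat_rcons; case: s => [|g s] /=.
  by rewrite prefix0s andbT eq_sym andbC.
rewrite cat_path rcons_path /= prefix0s andbT [ebar e == f]eq_sym.
by rewrite -!andbA; congr (_ && _); congr (_ && _); rewrite andbC.
Qed.

Lemma reduced_decide x s : reduced s ->
  evt x [set q | reduced (s ++ pseq q)] \/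
  evt x (~` [set q | reduced (s ++ pseq q)]).
Proof.
move=> rs; case: (lastP s) rs => [|s' e] rs.
  left; apply: evtS (evtT x) => q _ /=; exact: rpath_reduced.
have [|] := evt_prefix x [:: ebar e]; last first.
  move=> h; left; apply: evtS h => q /= /negP h.
  by rewrite reduced_cat_last rs rpath_reduced.
move=> h; right; apply: evtS h => q /= h.
by rewrite reduced_cat_last h !andbF.
Qed.

Lemma mkseq_cat (T : Type) (v : nat -> T) i j :
  mkseq v (i + j) = mkseq v i ++ [seq v k | k <- iota i j].
Proof. by rewrite /mkseq iotaD map_cat. Qed.

(** The path in the forest does not backtrack, so its labels form a reduced sequence and nothing
    cancels when they are multiplied. *)
Lemma ipath_labels (w : nat -> edge Et) (v : nat -> edge E) l :
  is_ipath w -> org (w 0) = vpath l ->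
  (forall i, elabel (w i) = [:: v i]) ->
  forall i, porg (org (w i) : rpath E) = l /\
    pseq (org (w i) : rpath E) = mkseq v i.
Proof.
move=> wp w0 wv.
have wS i : ter (w i) = org (w i.+1) by have /andP[/eqP] := wp i.
have vS i : v i.+1 != ebar (v i).
  have /andP[_] := wp i; apply: contraNneq => vi; apply/eqP/edge_eq.
    by rewrite -wS org_ebar.
  rewrite wv vi /elabel /= dif_sym ?edge_porg // -/(elabel (w i)).
  by rewrite wv.
have red n : reduced (mkseq v n).
  rewrite /reduced /mkseq sorted_map; case: n => //= n.
  by elim: n 0 => //= n IHn m; rewrite vS IHn.
elim=> [|i [IHo IHs]]; first by rewrite w0.
have oi : porg (org (w i) : rpath E) = porg (org (w i.+1) : rpath E).
  by rewrite -wS edge_porg.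
split; first by rewrite -oi.
rewrite (pseq_dif oi) IHs -wS -/(elabel (w i)) wv.
by rewrite -[RHS]reduce_id // -addn1 mkseq_cat.
Qed.

(** From the stable index [j0] on, the words along [w] only grow, and their limit [v] is the wanted
    infinite path. The path of its initial segments starts at [lambda x] and merges with [w]. *)
Lemma end_underline x (w : nat -> edge Et) : idirected w ->
  ufval x = end_uf w -> exists v, is_underline x (inr v).
Proof.
move=> wd xw; have [j0 stab] := end_stable wd.
pose q i : rpath E := org (w (j0 + i)); pose k := size (pseq (q 0)).
have q0 : q 0 = org (w j0) by rewrite /q addn0.
have wS i : ter (w i) = org (w i.+1) by have [/(_ i)/andP[/eqP]] := wd.
have qq i : cell (q 0) [::] (q i) /\ size (dif (q 0) (q i)) = i.
  rewrite q0; have [ci ->] := idirected_cell wd (leq_addr i j0).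
  by rewrite addKn; split.
have sq i : size (pseq (q i)) = k + i.
  have [qi si] := qq i; rewrite q0 in qi si.
  by rewrite (stab _ qi) size_cat si /k q0.
have pS i : prefix (pseq (q i)) (pseq (q i.+1)).
  have [qi _] := qq i; have [qSi _] := qq i.+1.
  have [|qiS _] := @idirected_cell _ w (j0 + i) (j0 + i.+1) wd _.
    by rewrite leq_add2l.
  rewrite q0 in qi qSi; rewrite (stab _ qi) (stab _ qSi).
  by rewrite (dif_cat qi qiS) catA prefix_prefix.
have pL i j : prefix (pseq (q i)) (pseq (q (i + j))).
  elim: j => [|j IHj]; first by rewrite addn0 prefix_refl.
  by rewrite addnS; apply: prefix_trans IHj (pS _).
have [d _] := elabelP (w 0).
(* The word of [q i.+1] has length [k + i.+1], so the default value [d] is never returned. *)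
pose v i := nth d (pseq (q i.+1)) i.
have vE m i : i < k + m -> nth d (pseq (q m)) i = v i.
  move=> im; rewrite /v.
  have pn a c : i < size (pseq (q a)) ->
      nth d (pseq (q (a + c))) i = nth d (pseq (q a)) i.
    by move=> ia; have /prefixP[t ->] := pL a c; rewrite nth_cat ia.
  have [le|/ltnW le] := leqP m i.+1.
    by rewrite -(subnKC le) pn // sq.
  by rewrite -(subnKC le) pn // sq addnC leq_addr.
have mv m i : i <= k + m -> mkseq v i = take i (pseq (q m)).
  move=> im; have sz : size (take i (pseq (q m))) = i.
    by rewrite size_takel // sq.
  apply: (@eq_from_nth _ d); first by rewrite size_mkseq sz.
  move=> a; rewrite size_mkseq => ai; rewrite nth_mkseq // nth_take // vE //.
  exact: leq_trans im.
have xq : evt x (cell (q 0) [::]).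
  apply: uf_evt; rewrite xw; split; first exact: ringA_cell.
  by exists j0; rewrite reachE q0.
have lq : lambda x = porg (q 0) by apply: lambdaE; apply: evtS xq => u [].
have rp i : is_rpath (lambda x, mkseq v i).
  rewrite (@mv i i) ?leq_addl //; have [p [u [po ps _ _ _]]] :=
    rpath_take (esym (cat_take_drop i (pseq (q i)))).
  have -> : (lambda x, take i (pseq (q i))) = rpval p; last exact: (valP p).
  rewrite -ps lq -(cell_porg (qq i).1) -po.
  by rewrite /porg /pseq; case: (rpval p).
pose n i := RPath (rp i).
have dn i : dif (n i) (n i.+1) = [:: v i].
  rewrite difE // /n /pseq /= -addn1 mkseq_cat catA -reduce_catl.
  by rewrite reduce_invsl.
have cn i : is_cedge (n i, n i.+1).
  by apply/andP; split=> //; rewrite /plen -/(dif _ _) dn.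
pose w' i : edge Et := CEdge (cn i).
have nq i : n (k + i) = q i.
  apply: rpath_eq; first by rewrite (cell_porg (qq i).1) -lq.
  by rewrite /pseq /= (@mv i) // -sq take_size.
(* The initial segment of length [k] is the word of [q 0], so the new path agrees from [k] on with
   the old one from [j0] on. *)
have tl : itail k w' = itail j0 w.
  apply/funext => i; apply: val_inj; rewrite /itail /= nq -addnS nq /q.
  by rewrite addnS -wS; case: (w (j0 + i)) => -[].
have wd' : idirected (itail j0 w).
  by have [wp we] := wd; split=> i; rewrite /itail ?addnS;
    [apply: wp | apply: we].
exists v, w'; split.
- move=> i; apply/andP; split=> //; apply/eqP => /(congr1 (@ter Et)) /=.
  move/(congr1 (fun p => size (pseq p))); rewrite /n /pseq /=.
  rewrite size_map size_iota => /eqP; rewrite gtn_eqF //.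
  by rewrite size_mkseq ltnS leqnSn.
- exact: rpath_eq.
- exists k; rewrite tl xw; split=> //.
  have [_ mx] := end_uf_ultra wd'; apply: mx.
    by have [] := end_uf_ultra wd.
  by move=> B [rB [j jB]]; split=> //; exists (j0 + j).
- exact: dn.
Qed.

Lemma underlineP x : is_underline x (underline x).
Proof.
rewrite /underline; case: xgetP => [u _ //|nu]; exfalso.
have [[q xq]|[w wd xw]] := spec_point x; first exact: (nu (inl q)).
by have [v xv] := end_underline wd xw; apply: (nu (inr v)).
Qed.

(** Reducedness is decided by [reduced_decide], and a decided property can be tested at the vertex
    [p], or at late vertices of the path in the forest that represents the end. *)
Lemma no_cancelE b x :
  no_cancel b (underline x) <-> evt x [set q | reduced (pseq b ++ pseq q)].
Proof.
have := underlineP x.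
case: (underline x) => [p /= xp|v [w [wp w0 [k [wd xw]] wv]]].
  have xpP P : evt x P -> P p by move=> [B]; rewrite xp => -[_ Bp]; apply.
  split=> [nc|h i]; last first.
    have := xpP _ h; rewrite /= -{1}(cat_take_drop i (pseq p)) catA.
    exact: reduced_catl.
  have [//|] := reduced_decide x (rpath_reduced b).
  by move/xpP => /=; have := nc (size (pseq p)); rewrite /= take_size => ->.
have wE := ipath_labels wp w0 wv.
(* Only the tail of [w] from [k] on is known to be directed, so the index [j] of the tail becomes
   [k + j]. *)
have xwP P : evt x P -> exists j0, forall j, j0 <= j -> P (org (w j)).
  move=> [B]; rewrite xw => -[_ [j jB]] BP; exists (k + j) => i ji.
  apply: BP; apply: jB; rewrite reachE /itail.
  have kji : j <= i - k by rewrite leq_subRL // (leq_trans _ ji) // leq_addr.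
  have [+ _] := idirected_cell wd kji; rewrite /itail subnKC //.
  by rewrite (leq_trans _ ji) // leq_addr.
split=> [nc|h i].
  have [//|] := reduced_decide x (rpath_reduced b).
  move=> /xwP[j /(_ j (leqnn j))] /=; have [_ ->] := wE j.
  by have := nc j; rewrite /= => ->.
have [j jh] := xwP _ h; have := jh (i + j) (leq_addl i j).
have [_ /= ->] := wE (i + j); rewrite mkseq_cat catA; exact: reduced_catl.
Qed.

End Underline.

(** * The cocycle *)

Section Cocycle.
Variable E : digraph.
Local Notation Et := (forest_of E).
Implicit Types (e f : edge E) (s t : seq (edge E)) (p q b : rpath E).
Implicit Types (x y : spec Et) (P : set (rpath E)).

(** Multiplication by [p] turns a word [b2 q], with [q] along [x], into [b1 q], and neither product
    has cancellations. Hence all decompositions of [(p, y)] have the same length difference. *)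
Lemma decomposition_length p y b1 b2 x : decomposition (p, y) b1 b2 x ->
  evt y [set q |
    size (reduce (pseq p ++ pseq q)) + plen b2 = size (pseq q) + plen b1].
Proof.
move=> [[b1x b2x] [/= -> ->] /no_cancelE h1 /no_cancelE h2 _].
apply/evt_act => //; apply: evtS (evtI (lambdaP x) (evtI h1 h2)).
move=> q /= [qx [r1 r2]]; split; first by rewrite qx.
have pq : pter b2 = porg q by rewrite qx.
have p1q : pter b1 = porg q by rewrite qx.
have p12 : pter b1 = porg (pinv b2) by rewrite porg_pinv b1x.
rewrite /= -[reduce _]pseq_pmul; last first.
  by rewrite pter_pmul ?pter_pinv ?porg_pmul.
rewrite -pmulA ?pter_pinv ?porg_pmul // pmulVK // !pseq_pmul //.
by rewrite !reduce_id // !size_cat /plen addnC addnA addnAC [_ + size _]addnC.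
Qed.

(** Write [p^-1 = b2 c] with [b2] the longest initial segment shared with the words along [y]; then
    [b1 = c^-1] and [x = b2^-1 y]. *)
Lemma decomposition_ex p y : pter p = lambda y ->
  exists b1 b2 x, decomposition (p, y) b1 b2 x.
Proof.
move=> py; pose I := pseq (pinv p).
pose P k := (k <= size I) && `[< evt y [set q | prefix (take k I) (pseq q)] >].
have exP : exists k, P k.
  exists 0; apply/andP; split=> //; apply/asboolP.
  by apply: evtS (evtT y) => q _ /=; rewrite take0 prefix0s.
have ubP k : P k -> k <= size I by case/andP.
case: (ex_maxnP exP ubP) => k /andP[kI /asboolP yk] kmax.
have [b2 [c [b2o b2s b2c cs pE]]] := rpath_take (esym (cat_take_drop k I)).
have y2 : porg b2 = lambda y by rewrite b2o porg_pinv.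
have y2' : pter (pinv b2) = lambda y by rewrite pter_pinv.
pose x := act (pinv b2) y; have lx : lambda x = pter b2.
  by rewrite /x lambda_act // porg_pinv.
have red2 : evt x [set q | reduced (pseq b2 ++ pseq q)] /\
    evt x [set q | reduced (pseq (pinv c) ++ pseq q)].
  have h : evt y [set q | exists r, [/\ pseq q = pseq b2 ++ r,
      reduced r & reduced (pseq (pinv c) ++ r)]].
    have [kI'|kI'] := leqP (size I) k.
      apply: evtS yk => q; rewrite take_oversize // => /prefixP[r qr].
      exists r; rewrite b2s take_oversize // pseq_pinv cs drop_oversize //.
      have rr : reduced r.
        by apply: (@reduced_catr _ I); rewrite -qr rpath_reduced.
      by split.
    (* By maximality of [k], the words along [y] do not continue with the next letter of [p^-1], the
       only one that could cancel against [c^-1]. *)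
    have [yk1|yk1] := evt_prefix y (take k.+1 I).
      have /kmax : P k.+1 by rewrite /P kI'; apply/asboolP.
      by rewrite ltnn.
    apply: evtS (evtI yk yk1) => q [/prefixP[r qr] nqr].
    have rr : reduced r.
      by apply: (@reduced_catr _ (take k I)); rewrite -qr rpath_reduced.
    exists r; split=> //; first by rewrite b2s.
    rewrite pseq_pinv cs; case dk : (drop k I) => [|g t].
      by move: (congr1 size dk); rewrite size_drop => /eqP;
        rewrite subn_eq0 leqNgt kI'.
    rewrite invs_cons reduced_cat_last -invs_cons reduced_invs rr ebarK.
    rewrite -dk -cs rpath_reduced /=.
    apply/negP => /prefixP[r' er']; apply: nqr; apply/prefixP; exists r'.
    by rewrite qr er' -addn1 takeD dk /= take0 -catA.
  split; apply/evt_act => //; apply: evtS (evtI (lambdaP y) h);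
    move=> q /= [qy [r [qr rr r1]]]; (split; first by rewrite y2');
    rewrite /= pseq_pmul ?y2' // (pseq_pinv b2) qr catA -reduce_catl;
    rewrite reduce_invsl /= reduce_id //.
  by rewrite -qr rpath_reduced.
exists (pinv c), b2, x; split.
- by rewrite pter_pinv lx.
- split; first by rewrite /= -[p]pinvK pE pinvM.
  by rewrite /= /x actKV.
- by apply/no_cancelE; have [] := red2.
- by apply/no_cancelE; have [] := red2.
move=> i /=; have : reduced (pseq (pinv c) ++ pseq (pinv b2)).
  rewrite !pseq_pinv -invs_cat cs b2s cat_take_drop reduced_invs.
  exact: rpath_reduced.
by rewrite -{1}(cat_take_drop i (pseq (pinv b2))) catA => /reduced_catl.
Qed.

Lemma cocycle0P p y : pter p = lambda y -> cocycle (p, y) = 0%R <->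
  evt y [set q | size (reduce (pseq p ++ pseq q)) = size (pseq q)].
Proof.
move=> py; rewrite /cocycle; case: xgetP => [m _ /= [b1 [b2 [x [d ->]]]]|nd].
  have h := decomposition_length d; split=> [/eqP|h'].
    rewrite GRing.subr_eq0 => /eqP[bb]; apply: evtS h => q /=.
    by rewrite bb => /addIn.
  have [q [/= q1 q2]] := evt_ex (evtI h h'); move: q1; rewrite q2.
  by move=> /addnI ->; rewrite GRing.subrr.
exfalso; have [b1 [b2 [x d]]] := decomposition_ex py.
by apply: (nd ((plen b1)%:Z - (plen b2)%:Z)%R); exists b1, b2, x.
Qed.

End Cocycle.

(** * The kernel of the cocycle as an etale groupoid *)

Section Kernel.
Variable E : digraph.
Local Notation Et := (forest_of E).
Local Notation X := (rpath E * spec Et)%type.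
Implicit Types (e f : edge E) (s t : seq (edge E)) (p q b : rpath E).
Implicit Types (x y z : spec Et) (P : set (rpath E)) (a c : X) (W : set X).

(** The path groupoid is discrete, so neighbourhoods can be tested on the slice through [p]. *)
Lemma nbhs_pairP p y W : nbhs (p, y) W <-> nbhs y [set z | W (p, z)].
Proof.
split=> [[[A B] /= [pA yB] AB]|yW].
  by apply: filterS yB => z Bz; apply: AB; split=> //; apply: nbhs_singleton pA.
exists ([set p], [set z | W (p, z)]); last by case=> q z [/= ->].
by split=> //; apply: discrete_set1.
Qed.

Lemma open_pairP W : open W <-> forall p, open [set z | W (p, z)].
Proof.
split=> [oW p|oW].
  by rewrite openE => z Wz; apply/nbhs_pairP/open_nbhs_nbhs.
rewrite openE => -[p y] Wy; apply/nbhs_pairP; apply: open_nbhs_nbhs.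
by split=> //; apply: oW.
Qed.

Definition eqlen p : set (rpath E) :=
  [set q | size (reduce (pseq p ++ pseq q)) = size (pseq q)].

Lemma eqlen_pmul p q y : pter p = porg q -> pter q = lambda y ->
  evt (act q y) (eqlen p) -> evt y (eqlen q) -> evt y (eqlen (pmul p q)).
Proof.
move=> pq qy /(evt_act _ qy) h1 h2; apply: evtS (evtI h1 h2).
move=> u [[uq]]; rewrite /eqlen /= !pseq_pmul // => + <-.
by rewrite reduce_catl reduce_catr catA => ->.
Qed.

Lemma eqlen_pinv p y : pter p = lambda y ->
  evt y (eqlen p) -> evt (act p y) (eqlen (pinv p)).
Proof.
move=> py h; apply/evt_act => //; apply: evtS (evtI (lambdaP y) h).
move=> u [/= uy eu]; split; rewrite ?py //; rewrite /eqlen /=.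
rewrite pseq_pmul ?py // reduce_catr eu pseq_pinv catA -reduce_catl.
by rewrite reduce_invsl reduce_id // rpath_reduced.
Qed.

Lemma eqlen_vpath v y : evt y (eqlen (vpath v)).
Proof.
by apply: evtS (evtT y) => q _; rewrite /eqlen /= reduce_id // rpath_reduced.
Qed.

Lemma prefix_act b x : pter b = lambda x ->
  evt x [set q | reduced (pseq b ++ pseq q)] ->
  evt (act b x) [set q | exists r, pseq q = pseq b ++ r].
Proof.
move=> bx h; apply/evt_act => //; apply: evtS (evtI (lambdaP x) h).
move=> q [/= qx rq]; split; first by rewrite qx.
by exists (pseq q); rewrite /= pseq_pmul ?bx // reduce_id.
Qed.

Lemma eqlen_decomposition p y : pter p = lambda y -> evt y (eqlen p) ->
  exists b1 b2 x, decomposition (p, y) b1 b2 x /\ plen b1 = plen b2.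
Proof.
move=> py h; have [b1 [b2 [x d]]] := decomposition_ex py.
exists b1, b2, x; split=> //.
have [q [/= + q2]] := evt_ex (evtI (decomposition_length d) h).
by rewrite q2 => /addnI.
Qed.

(** In a decomposition with equal lengths, [act p y = y] makes [b1] and [b2] initial segments of the
    same length of the same words, so they coincide. *)
Lemma eqlen_fix p y : pter p = lambda y -> evt y (eqlen p) -> act p y = y ->
  p = vpath (lambda y).
Proof.
move=> py h pyy; have [b1 [b2 [x [d bb]]]] := eqlen_decomposition py h.
case: d => -[b1x b2x] [/= pE yE] /no_cancelE h1 /no_cancelE h2 _.
have y1 : y = act b1 x.
  rewrite -pyy {1}pE yE act_mul ?pter_pmul ?pter_pinv ?porg_pinv ?b1x //.
  by rewrite -pmulA ?pter_pinv ?porg_pinv ?b1x // pmulVp pmulp1 ?b1x.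
have e1 := prefix_act b1x h1; have e2 := prefix_act b2x h2.
rewrite -y1 in e1; rewrite -yE in e2.
have [q [[r1 q1] [r2 q2]]] := evt_ex (evtI e1 e2).
have bE : b1 = b2.
  apply: rpath_eq; first by rewrite -(lambda_act b1x) -(lambda_act b2x) -yE -y1.
  rewrite -(take_size_cat r1 bb) -[LHS]/(take _ _).
  by rewrite -q1 q2 take_size_cat.
by rewrite pE bE pmulpV yE lambda_act.
Qed.

Variable K : set (spec Et).
Hypothesis Kinv : invariant_set K.
Local Notation H := (cocycle_kernel K).
Local Notation D := (transf_ops E).

Lemma kernelP p y : H (p, y) <-> [/\ K y, pter p = lambda y & evt y (eqlen p)].
Proof.
split=> [[[/= Ky py] /(cocycle0P py)]|[Ky py h]] //.
by split=> //; apply/cocycle0P.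
Qed.

Lemma kernel_composable a c : gsrc D a = grng D c -> a.2 = act c.1 c.2.
Proof. by case=> _. Qed.

Lemma kernel_unit y : K y -> H (vpath (lambda y), y).
Proof. by move=> Ky; apply/kernelP; split=> //; apply: eqlen_vpath. Qed.

Lemma kernel_closed : gpd_closed D H.
Proof.
split.
- by move=> [p y] /kernelP[Ky _ _]; apply: kernel_unit.
- by move=> [p y] /kernelP[Ky py _]; apply: kernel_unit; apply: Kinv.
- move=> [p y] /kernelP[Ky py h]; apply/kernelP; split; first exact: Kinv.
    by rewrite pter_pinv lambda_act.
  exact: eqlen_pinv.
- move=> [p y'] [q y] /kernelP[_ py' h'] /kernelP[Ky qy h].
  move=> /kernel_composable /= yE; rewrite {}yE in py' h'.
  rewrite lambda_act // in py'.
  by apply/kernelP; split; rewrite ?pter_pmul //; apply: eqlen_pmul.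
Qed.

Lemma kernel_groupoid : is_groupoid D H.
Proof.
split; first exact: kernel_closed.
- move=> [p y] /kernelP[Ky py _] /=.
  have e z : act (vpath (lambda z)) z = z by apply: act_vpath.
  by split; rewrite /= ?e.
- move=> [p y'] [q y] /kernelP[_ py' _] /kernelP[_ qy _].
  move=> /kernel_composable /= yE; rewrite yE lambda_act // in py'.
  by split; rewrite /= // yE act_mul.
- move=> [p y2] [q y1] [u y] /kernelP[_ py _] /kernelP[_ qy _] /kernelP[_ uy _].
  move=> /kernel_composable e2 /kernel_composable e1; move: e2 e1 => /= e2 e1.
  rewrite /= pmulA //; first by rewrite py e2 lambda_act.
  by rewrite qy e1 lambda_act.
- move=> [p y] /kernelP[Ky py _].
  split; rewrite /= ?pmulp1 ?lambda_act ?pmul1p ?pmulVp ?pmulpV ?actVK ?py //.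
    by rewrite porg_pinv py.
  exact: pter_pinv.
Qed.

(** Two arrows with equal source and range differ by [q^-1 p], which fixes the source and eventually
    preserves lengths, hence is a unit by [eqlen_fix]. *)
Lemma kernel_principal : is_principal D H.
Proof.
move=> [p y] [q z] Hp Hq [_ yz] [_]; rewrite /= -yz in Hq * => pqy.
have [Ky py hp] := (kernelP _ _).1 Hp; have [_ qy hq] := (kernelP _ _).1 Hq.
have pq : porg p = porg q by rewrite -(lambda_act py) pqy lambda_act.
have qp : pter (pinv q) = porg p by rewrite pter_pinv.
have uy : pter (pmul (pinv q) p) = lambda y by rewrite pter_pmul.
have /(eqlen_fix uy) : evt y (eqlen (pmul (pinv q) p)).
  by apply: eqlen_pmul => //; rewrite pqy; apply: eqlen_pinv.
rewrite -act_mul // pqy actVK // => /(_ erefl) e.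
congr pair; rewrite -[p](@pmulKV _ q) // e pmulp1 //.
Qed.

Lemma kernel_topological : is_topological D H.
Proof.
split; first exact: kernel_groupoid.
  apply/subspace_continuousP => -[p y] /kernelP[_ py _] O /nbhs_pairP nO.
  apply/nbhs_pairP; apply: filterS (act_nbhs py nO) => z [pz Oz] _.
  exact: Oz.
apply/subspace_continuousP => -[[p y'] [q y]] [_ _ _] O /nbhs_pairP nO.
exists ([set a | a.1 = p], [set a | a.1 = q /\ O (pmul p q, a.2)]).
  split; apply/nbhs_pairP; first by apply: filterS (@filterT _ (nbhs y') _).
  by apply: filterS nO => z Oz.
by move=> [[p1 z'] [q1 z]] /= [-> [-> Oz]] _.
Qed.

Lemma kernel_units : gpd_units D H = [set (vpath (lambda y), y) | y in K].
Proof.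
apply/seteqP; split=> [_ [[p y] /kernelP[Ky _ _] <-]|_ [y Ky <-]].
  by exists y.
by exists (vpath (lambda y), y) => //; apply: kernel_unit.
Qed.

Lemma kernel_etale : is_etale D H.
Proof.
split; first exact: kernel_topological.
(* The slice with first component [p] is open, and the source map is injective on it. *)
move=> [p y] /kernelP[Ky py h]; exists [set a | a.1 = p]; split=> //.
- apply/open_pairP => q.
  have [->|npq] := pselect (q = p).
    rewrite (_ : [set z | _] = setT) //; first exact: openT.
    by apply/seteqP; split.
  rewrite (_ : [set z | _] = set0) //; first exact: open0.
  by apply/seteqP; split.
- move=> [q z] [q' z'] /set_mem[_ /= ->] /set_mem[_ /= ->] [_ ->] //.
- apply/subspace_continuousP => -[q z] _ O /nbhs_pairP nO.
  apply/nbhs_pairP; apply: filterS (filterI nO (nbhs_lambda z)).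
  move=> z' [Oz /= lz] _; suff: O (vpath (lambda z'), z') by [].
  by rewrite lz.
move=> W oW.
(* The conditions concern the second component only, which determines a unit. *)
exists [set a | [/\ W (p, a.2), pter p = lambda a.2 & evt a.2 (eqlen p)]].
  apply/open_pairP => q /=.
  have -> : [set z | [/\ W (p, z), pter p = lambda z & evt z (eqlen p)]] =
      [set z | W (p, z)] `&` [set z | evt z [set q | porg q = pter p]] `&`
      [set z | evt z (eqlen p)].
    apply/seteqP; split=> z; first by case=> Wz pz hz; do 2?split=> //=;
      rewrite pz; apply: lambdaP.
    by case=> [[Wz /lambdaE pz] hz].
  apply: openI; last exact: open_evt.
  by apply: openI; [move/open_pairP: oW | exact: open_evt].
rewrite kernel_units; apply/seteqP; split=> a.
  case=> -[q z] [[/kernelP[Kz pz hz] /= qp] Wz] <-; rewrite qp in pz hz Wz.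
  by split; [exists z | split].
case=> [[z Kz <-] [/= Wz pz hz]]; exists (p, z) => //; split=> //.
by split=> //; apply/kernelP.
Qed.

Lemma kernel_totally_disconnected : totally_disconnected (gpd_units D H).
Proof.
rewrite kernel_units => _ [x Kx <-]; apply/seteqP; split; last first.
  by move=> _ ->; apply: connected_component_refl; exists x.
move=> a [R [Rx RK cR] Ra]; have [y Ky ya] := RK _ Ra.
rewrite -{a}ya in Ra *; have [->//|xy] := eqVneq y x.
have [B [C [yB xC BC]]] := spec_separate xy.
have fB (A : set (spec Et)) : open A -> open [set a : X | A a.2].
  by move=> oA; apply/open_pairP.
(* The arrows over [B] form a clopen set, which contains the connected set [R] once it meets it. *)
suff : (R `&` [set a : X | ufval a.2 B]) (vpath (lambda x), x).
  by case=> _ /= xB; exfalso; apply: (@uf0 _ x); rewrite -BC; apply: ufI.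
rewrite (cR (R `&` [set a : X | ufval a.2 B])) //.
- by exists (vpath (lambda y), y).
- exists [set a : X | ufval a.2 B] => //.
  apply: (fB [set z : spec Et | ufval z B]).
  exact/open_uf/(ufR yB).
- exists [set a : X | ufval a.2 B] => //; rewrite -[X in closed X]setCK.
  apply: open_closedC; apply: (fB (~` [set z : spec Et | ufval z B])).
  exact/closed_openC/closed_uf/(ufR yB).
Qed.

End Kernel.

(** * Elementary subgroupoids *)

Section ClosedSubspace.
Variable T : topologicalType.
Variable C : set T.

Lemma nbhs_set_typeP (u : C) (S : set C) :
  nbhs u S <-> exists2 O, nbhs (\val u : T) O & forall v : C, O (\val v) -> S v.
Proof.
split=> [[_ [[O oO <-] /= uO] OS]|[O + OS]].
  by exists O => //; apply: open_nbhs_nbhs.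
move=> uO; suff : nbhs u [set v : C | O (\val v)] by apply: filterS => v /OS.
exact: (@initial_continuous C T set_val u).
Qed.

Lemma set_type_hausdorff : hausdorff_space T -> hausdorff_space (set_type C).
Proof.
move=> hT u v cuv; apply: val_inj; apply: hT => A B uA vB.
have nA : nbhs u [set w : C | A (\val w)] by apply/nbhs_set_typeP; exists A.
have nB : nbhs v [set w : C | B (\val w)] by apply/nbhs_set_typeP; exists B.
by have [w [wA wB]] := cuv _ _ nA nB; exists (\val w).
Qed.

Lemma set_type_locally_compact : closed C ->
  (forall x : T, exists B, [/\ nbhs x B, compact B & closed B]) ->
  locally_compact [set: set_type C].
Proof.
move=> cC lT u _; have [B [uB cptB cB]] := lT (\val u).
exists [set v : C | B (\val v)].
  apply: filterS (_ : nbhs u [set v : C | B (\val v)]) => [v Bv _ //|].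
  by apply/nbhs_set_typeP; exists B.
split; last first.
  apply: (closed_comp _ cB) => v _.
  exact: (@initial_continuous C T set_val v).
move=> F FF FB; pose G : set_system T := (fun v : C => \val v) @ F.
have [x [Bx cx]] : B `&` cluster G !=set0 by apply: cptB.
have Cx : C x.
  apply: cC => O xO; have [|z [Cz Oz]] := cx C O _ xO; last by exists z.
  suff : F [set v : C | C (\val v)] by [].
  by apply: filterS (@filterT _ F _) => v _; apply: set_valP.
exists (exist _ x (mem_set Cx) : C); split=> //.
move=> S N FS /nbhs_set_typeP[O xO ON].
have [|_ [[v Sv <-] Ov]] := cx [set \val v | v in S] O _ xO.
  suff : F [set v : C | [set \val v | v in S] (\val v)] by [].
  by apply: filterS FS => v Sv; exists v.
by exists v; split=> //; apply: ON.
Qed.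

End ClosedSubspace.

Lemma Tagged_inj (I : eqType) (T_ : I -> Type) (i : I) (x y : T_ i) :
  Tagged T_ x = Tagged T_ y -> x = y.
Proof. by move=> /(congr1 (tagged_as (Tagged T_ x))); rewrite !tagged_asE. Qed.

Section Elementary.
Variable E : digraph.
Local Notation Et := (forest_of E).
Local Notation X := (rpath E * spec Et)%type.
Variables (F : seq (edge E)) (Fbar : {in F, forall e, ebar e \in F}) (n : nat).
Implicit Types (e f : edge E) (s t r : seq (edge E)) (p q b : rpath E).
Implicit Types (x y z u : spec Et) (P : set (rpath E)) (a c : X) (W : set X).
Implicit Types (v : vert E).

(** * Splitting off the longest initial segment over [F] *)

Definition headF s : seq (edge E) :=
  if s is f :: _ then if f \in F then [:: f] else [::] else [::].

Definition lenF s : nat := minn n (find [predC F] s).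

(* [k] is the length of the longest initial segment with edges in [F], cut off
   at length [n], of words [b ++ r] with [size b = k] and [headF r = s]. *)
Definition compat (k : nat) s : bool := (k == n) || (k < n) && (s == [::]).

(** Compatibility means that [s] cannot be prolonged over [F] within length [n], so its length is
    recovered from the whole word. This makes the factorization unique. *)
Lemma lenF_cat s r : all [in F] s -> compat (size s) (headF r) ->
  lenF (s ++ r) = size s.
Proof.
move=> sF; have hs : has [predC F] s = false.
  by apply/negbTE; rewrite has_predC negbK.
rewrite /lenF find_cat hs => /orP[/eqP <-|/andP[sn]].
  by apply/minn_idPl; rewrite leq_addr.
case: r => [|f r] /=; first by rewrite addn0 => _; apply/minn_idPr/ltnW.
by case: ifPn => //= _ _; rewrite addn0; apply/minn_idPr/ltnW.
Qed.

Lemma headF_prefix r : prefix (headF r) r.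
Proof.
by case: r => //= f r; case: ifP => // _; rewrite /= eqxx prefix0s.
Qed.

(** A letter cancelling against the end of [s] is the reverse of an edge of [F], hence lies in [F]
    and is visible in [headF r]. *)
Lemma reduced_headF s r : all [in F] s -> reduced r -> reduced (s ++ headF r) ->
  reduced (s ++ r).
Proof.
case: (lastP s) => [//|s' e]; rewrite all_rcons => /andP[eF _] rr.
rewrite !reduced_cat_last rr => /and3P[-> _ /=].
case: r {rr} => //= f r; rewrite prefix0s andbT.
case: ifPn => [_ /=|nfF _]; first by rewrite andbT.
by apply: contra nfF => /eqP <-; apply: Fbar.
Qed.

Lemma headF_evt x : (exists2 f, f \in F &
    evt x [set q | prefix [:: f] (pseq q)]) \/
  evt x [set q | headF (pseq q) = [::]].
Proof.
have H (s : seq (edge E)) : (exists2 f, f \in s &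
    evt x [set q | prefix [:: f] (pseq q)]) \/
  evt x [set q | forall f, f \in s -> ~ prefix [:: f] (pseq q)].
  elim: s => [|f s [[g gs xg]|IHs]]; first by right; apply: evtS (evtT x).
    by left; exists g => //; rewrite inE gs orbT.
  have [xf|xf] := evt_prefix x [:: f].
    by left; exists f; rewrite ?mem_head.
  right; apply: evtS (evtI IHs xf) => q [qs qf] g.
  by rewrite inE => /orP[/eqP->|/qs].
have [|h] := H F; first by left.
right; apply: evtS h => q; rewrite /headF /=; case: (pseq q) => //= f s h.
by case: ifPn => // fF; case: (h f fF); rewrite eqxx prefix0s.
Qed.

Lemma headF_const x : exists s, evt x [set q | headF (pseq q) = s].
Proof.
have [[f fF xf]|] := headF_evt x; last by exists [::].
exists [:: f]; apply: evtS xf => q /=.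
by case: (pseq q) => //= g s /andP[/eqP <- _]; rewrite fF.
Qed.

(** Induction on [n]: an initial edge in [F] is split off repeatedly, until [n] edges are removed or
    the words no longer begin with an edge of [F]. *)
Lemma extract y : exists b u s, [/\ pter b = lambda u, y = act b u,
  all [in F] (pseq b), evt u [set q | reduced (pseq b ++ pseq q)] &
  compat (size (pseq b)) s /\ evt u [set q | headF (pseq q) = s]].
Proof.
rewrite /compat; elim: n y => [|m IHm] y.
  have [s ys] := headF_const y; exists (vpath (lambda y)), y, s.
  split=> //; first by rewrite act_vpath.
  by apply: evtS (evtT y) => q _; apply: rpath_reduced.
have [[f fF yf]|h] := headF_evt y; last first.
  exists (vpath (lambda y)), y, [::]; split=> //; first by rewrite act_vpath.
  by apply: evtS (evtT y) => q _; apply: rpath_reduced.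
have fy : porg (epath f) = lambda y.
  apply/esym/lambdaE; apply: evtS yf => q /=; have := rpath_walk q.
  by case: (pseq q) => //= g s /andP[/eqP <- _] /andP[/eqP <- _].
have fy' : pter (pinv (epath f)) = lambda y by rewrite pter_pinv.
have [b [u [s [bu xE bF h [k us]]]]] := IHm (act (pinv (epath f)) y).
(* Records that [f] does not cancel against the remaining words, so that it can be put back in front
   of [b]. *)
have xf : evt (act (pinv (epath f)) y) [set q | reduced (f :: pseq q)].
  apply/evt_act => //; apply: evtS (evtI (lambdaP y) yf) => q [/= qy qf].
  split; first by rewrite fy'.
  have := rpath_reduced q; move/prefixP: qf => [r qr]; rewrite qr /= => rr.
  rewrite /= pseq_pmul ?fy' // pseq_pinv qr -cat1s catA -reduce_catl.
  rewrite reduce_invsl /= reduce_id //; exact: (@reduced_catr _ [:: f]).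
have fb : pter (epath f) = porg b.
  by rewrite -(lambda_act bu) -xE lambda_act // porg_pinv.
have h' : evt u [set q | reduced (f :: pseq b ++ pseq q)].
  rewrite xE in xf; move/(evt_act _ bu): xf => xf.
  apply: evtS (evtI h xf) => q /= [r1 [qb]].
  by rewrite /= pseq_pmul // reduce_id.
have fbE : pseq (pmul (epath f) b) = f :: pseq b.
  have [q /= rq] := evt_ex h'; rewrite pseq_pmul //= -[RHS]reduce_id //.
  exact: (@reduced_catl _ _ (pseq q)).
exists (pmul (epath f) b), u, s; rewrite fbE /= fF pter_pmul //; split=> //.
  by rewrite -act_mul // -xE actKV.
Qed.

Fixpoint words (k : nat) : seq (seq (edge E)) :=
  if k is k'.+1 then [seq f :: s | f <- F, s <- words k'] else [:: [::]].

Lemma mem_words k s : (s \in words k) = (size s == k) && all [in F] s.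
Proof.
elim: k s => [|k IHk] [|f s] //=.
  by apply/negbTE/negP => /allpairsP[[? ?] []].
rewrite eqSS; apply/allpairsP/and3P => [[[g t] /= [gF + [-> ->]]]|[sk fF sF]].
  by rewrite IHk => /andP[].
by exists (f, s); rewrite /= IHk sk.
Qed.

(** * The elementary model and its map onto [kernel_on] *)

Local Notation J := (nat * vert E * seq (edge E))%type.
Implicit Types j : J.

(* The index [j = ((k, v), s)] stands for the points [b x] where [b] has length
   [k], edges in [F] and endpoint [v], and [s] records the first edge of [x] if
   it lies in [F]. *)
Definition paths j : seq (rpath E) :=
  undup [seq b <- pmap (fun s => insub (head j.1.2 (map (@org E) s), s))
                       (words j.1.1) |
         (pter b == j.1.2) && reduced (pseq b ++ j.2)].

Lemma mem_paths j b : (b \in paths j) =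
  [&& size (pseq b) == j.1.1, all [in F] (pseq b), pter b == j.1.2 &
      reduced (pseq b ++ j.2)].
Proof.
rewrite mem_undup mem_filter; have [bv|_] := eqVneq (pter b) j.1.2.
  2: by rewrite !andbF.
rewrite /= andbC [RHS]andbA; congr (_ && _); rewrite mem_pmap -mem_words.
apply/mapP/idP => [[s sw /esym]|bw].
  by case: insubP => // b' _ b's [<-]; rewrite /pseq b's.
(* For the empty word the default value of [head] is the endpoint, which is then also the origin. *)
exists (pseq b) => //; have -> : (head j.1.2 (map (@org E) (pseq b)), pseq b) =
    \val b; last by rewrite valK.
rewrite [RHS]surjective_pairing -/(porg b) -/(pseq b); congr pair.
rewrite -bv; have := rpath_walk b; rewrite /pter.
by case: (pseq b) => //= e s /andP[/eqP].
Qed.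

Variable K : set (spec Et).
Hypotheses (Kclosed : closed K) (Kinv : invariant_set K).
Local Notation H := (cocycle_kernel K).
Local Notation D := (transf_ops E).

Definition kernel_on : set X :=
  H `&` [set a | all [in F] (pseq a.1) /\ size (pseq a.1) <= n.*2].

Definition tails j : set (spec Et) :=
  [set u | [/\ K u, lambda u = j.1.2 & evt u [set q | headF (pseq q) = j.2]]].

Lemma tails_closed j : closed (tails j).
Proof.
have -> : tails j = K `&` [set u | evt u [set q | porg q = j.1.2]] `&`
    [set u | evt u [set q | headF (pseq q) = j.2]].
  apply/seteqP; split=> u.
    by case=> Ku <- h; do 2?split=> //=; apply: lambdaP.
  by case=> [[Ku /lambdaE lu] h].
apply: closedI; first apply: closedI => //; apply: evt_decide_closed => x.
  have [e|e] := pselect (lambda x = j.1.2); [left|right];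
    apply: evtS (lambdaP x) => q /= ->; first exact: e.
  exact: e.
have [s xs] := headF_const x.
have [e|e] := pselect (s = j.2); [left|right];
  apply: evtS xs => q /= ->; first exact: e.
exact: e.
Qed.

(* For incompatible indices the factor [R_0] is empty, so that [tails j] needs
   no further condition. *)
Definition npaths j : nat := if compat j.1.1 j.2 then size (paths j) else 0.

Definition tail_space j : topologicalType := set_type (tails j).

Definition tail_point j u (Zu : tails j u) : tail_space j :=
  exist (fun u => u \in tails j) u (mem_set Zu).

Lemma tail_space_hausdorff j : hausdorff_space (tail_space j).
Proof. exact/set_type_hausdorff/spec_hausdorff. Qed.

Lemma tail_space_locally_compact j : locally_compact [set: tail_space j].
Proof.
apply: set_type_locally_compact; first exact: tails_closed.
move=> x; have [B xB] := uf_ex x; have rB := ufR xB.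
exists [set y | ufval y B]; split; [|exact: compact_uf|exact: closed_uf].
by apply/nbhs_spec; exists B.
Qed.

Local Notation Y := (elem_space tail_space npaths).

Definition path_at j (i : 'I_(npaths j)) : rpath E :=
  nth (vpath j.1.2) (paths j) i.

Lemma path_atP j (i : 'I_(npaths j)) : compat j.1.1 j.2 /\
  path_at i \in paths j.
Proof.
case: i => i; rewrite /path_at /npaths /=; case: ifP => // _ ip.
by split=> //; apply: mem_nth.
Qed.

Lemma path_at_inj j (i i' : 'I_(npaths j)) : path_at i = path_at i' -> i = i'.
Proof.
case: i i' => i ip [i' ip']; rewrite /path_at /= => e; apply: val_inj => /=.
move: ip ip'; rewrite /npaths; case: ifP => // _ ip ip'.
by apply/eqP; rewrite -(@nth_uniq _ (vpath j.1.2) (paths j)) ?undup_uniq ?e.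
Qed.

Lemma path_at_ex j b : compat j.1.1 j.2 -> b \in paths j ->
  exists i : 'I_(npaths j), path_at i = b.
Proof.
move=> k bp; have ib : index b (paths j) < npaths j.
  by rewrite /npaths k index_mem.
by exists (Ordinal ib); rewrite /path_at /= nth_index.
Qed.

(** The arrow [(a, b)] over [u] goes to the arrow from the point [b u] to the point [a u]. *)
Definition elem_map (w : Y) : X :=
  (pmul (path_at (projT2 w).2.1) (pinv (path_at (projT2 w).2.2)),
   act (path_at (projT2 w).2.2) (\val (projT2 w).1)).

Lemma tails_path j (u : tail_space j) (i : 'I_(npaths j)) :
  [/\ pter (path_at i) = lambda (\val u), all [in F] (pseq (path_at i)),
    size (pseq (path_at i)) = j.1.1,
    evt (\val u) [set q | reduced (pseq (path_at i) ++ pseq q)] &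
    compat j.1.1 j.2].
Proof.
have [k] := path_atP i; rewrite mem_paths => /and4P[/eqP sk bF /eqP bv rb].
have [Ku lu hu] := set_valP u.
split=> //; first by rewrite lu.
apply: evtS hu => q /= hq; apply: reduced_headF => //; last by rewrite hq.
exact: rpath_reduced.
Qed.

Lemma all_reduce (Q : pred (edge E)) s : all Q s -> all Q (reduce s).
Proof.
elim: s => //= e s IHs /andP[Qe /IHs]; rewrite /ccons.
by case: (reduce s) => [|f t] /=; [rewrite Qe | case: ifP => _ /andP[Qf Qt];
  rewrite /= ?Qe ?Qf].
Qed.

Lemma size_reduce s : size (reduce s) <= size s.
Proof.
elim: s => //= e s IHs; rewrite /ccons; case: (reduce s) IHs => // f t /= IHs.
by case: ifP => _ //=; apply: leq_trans (ltnW IHs) (leqnSn _).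
Qed.

Lemma all_invs s : all [in F] s -> all [in F] (invs s).
Proof.
by move=> sF; rewrite all_rev all_map; apply: sub_all sF => e /Fbar.
Qed.

Lemma elem_map_in (w : Y) : kernel_on (elem_map w).
Proof.
case: w => j [u [a b]]; rewrite /elem_map /=.
have [au aF sa ra k] := tails_path u a; have [bu bF sb rb _] := tails_path u b.
have [Ku lu hu] := set_valP u.
set p := path_at a in au aF sa ra *; set q := path_at b in bu bF sb rb *.
have pq : pter p = porg (pinv q) by rewrite porg_pinv au bu.
have kn : j.1.1 <= n by case/orP: k => [/eqP->|/andP[/ltnW]].
split; last first.
  rewrite /= pseq_pmul // pseq_pinv; split.
    by apply: all_reduce; rewrite all_cat aF all_invs.
  by rewrite (leq_trans (size_reduce _)) // size_cat size_invs sa sb addnn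
    leq_double.
apply/kernelP; split; first exact: Kinv.
  by rewrite pter_pmul // pter_pinv lambda_act.
apply/evt_act => //; apply: evtS (evtI (lambdaP _) (evtI ra rb)).
move=> r /= [ru [r1 r2]]; split; first by rewrite bu.
have qr : pter q = porg r by rewrite bu.
have pr : pter p = porg r by rewrite au.
rewrite /eqlen /= -pseq_pmul; last by rewrite pter_pmul ?pter_pinv ?porg_pmul.
rewrite -pmulA ?pter_pinv ?porg_pmul // pmulVK // !pseq_pmul //.
by rewrite !reduce_id // !size_cat sa sb.
Qed.

(** The words along the source have [lenF] equal to the length of the path [b]. Cutting them there
    gives [b] and the index, then the tail point, and [a] follows from the first component. *)
Lemma elem_map_inj : injective elem_map.
Proof.
move=> [j [u [a b]]] [j' [u' [a' b']]]; rewrite /elem_map /= => -[pE yE].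
have [au aF sa ra k] := tails_path u a; have [bu bF sb rb _] := tails_path u b.
have [au' aF' sa' ra' k'] := tails_path u' a'.
have [bu' bF' sb' rb' _] := tails_path u' b'.
have [Ku lu hu] := set_valP u.
have [Ku' lu' hu'] := set_valP u'.
have aux i (w : tail_space i) (c : 'I_(npaths i)) : tails i (\val w) ->
    evt (act (path_at c) (\val w)) [set q | exists r,
      [/\ pseq q = pseq (path_at c) ++ r, headF r = i.2 &
        lenF (pseq q) = i.1.1]].
  move=> [_ _ hw]; have [cw cF sc rc kc] := tails_path w c.
  apply/evt_act => //; apply: evtS (evtI (lambdaP _) (evtI rc hw)).
  move=> q /= [qw [rq hq]]; split; first by rewrite cw.
  exists (pseq q); rewrite pseq_pmul ?cw // reduce_id // lenF_cat // ?sc ?hq //.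
have h := aux _ u b (And3 Ku lu hu); have h' := aux _ u' b' (And3 Ku' lu' hu').
rewrite -yE in h'; have [q [[r [qr hr kq]] [r' [qr' hr' kq']]]] :=
  evt_ex (evtI h h').
have kk : j.1.1 = j'.1.1 by rewrite -kq kq'.
have sbb : pseq (path_at b) = pseq (path_at b').
  rewrite -(take_size_cat r sb) -(take_size_cat r' sb') -qr -qr' kk //.
have bE : path_at b = path_at b'.
  by apply: rpath_eq; rewrite // -(lambda_act bu) -(lambda_act bu') yE.
have rr : r = r'.
  by rewrite -(drop_size_cat r sb) -(drop_size_cat r' sb') -qr -qr' kk.
have jj : j = j'.
  have vv : j.1.2 = j'.1.2 by rewrite -lu -lu' -bu -bu' bE.
  have ss : j.2 = j'.2 by rewrite -hr -hr' rr.
  by move: kk vv ss; case: (j) (j') => -[? ?] ? [[? ?] ?] /= -> -> ->.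
clear - jj pE yE bE bu bu' au au'; subst j'.
have {bE} bb := path_at_inj bE; subst b'.
have uu : u = u' by apply: val_inj; rewrite -(actVK bu) yE actVK.
subst u'; suff -> : a = a' by [].
apply: path_at_inj; have ab : porg (pinv (path_at b)) = lambda (\val u).
  by rewrite porg_pinv.
move/(congr1 (fun p => pmul p (pinv (pinv (path_at b))))): pE.
by rewrite !pmulK ?ab.
Qed.

(** Write [t = p1 c^-1] with [c] the part cancelled against [s r]. Equal lengths force [p1] and [c]
    to have the same size, at most [n]. As [c] is over [F], it does not reach beyond [s], and [t]
    changes [s] only. *)
Lemma eqlen_extract t s r : reduced t -> reduced (s ++ r) -> all [in F] t ->
  all [in F] s -> size t <= n.*2 -> compat (size s) (headF r) ->
  size (reduce (t ++ (s ++ r))) = size (s ++ r) ->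
  exists s', [/\ reduce (t ++ s) = s', size s' = size s, all [in F] s' &
    reduced (s' ++ r)].
Proof.
move=> rp rsr pF sF sp k; have [p1 [c [r' [pE srE er]]]] :=
  reduce_cat_split rp rsr.
have : reduced (p1 ++ r') by rewrite -er reduce_reduced.
rewrite {}er srE !size_cat => rpr /addIn p1c.
have [p1F cF] : all [in F] p1 /\ all [in F] c.
  by move: pF; rewrite pE all_cat => /andP[-> /all_invs]; rewrite invsK.
have cn : size c <= n.
  by move: sp; rewrite pE size_cat size_invs p1c addnn leq_double.
(* Otherwise [c] would be an initial segment over [F], of length at most [n], that exceeds
   [lenF (s ++ r) = size s]. *)
have cs : size c <= size s.
  rewrite leqNgt; apply/negP => sc.
  have := lenF_cat sF k; rewrite srE /lenF find_cat.
  have -> : has [predC F] c = false.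
    by apply/negbTE; rewrite has_predC negbK.
  move=> e; move: (sc); rewrite -e ltnNge; apply/negP; rewrite negbK.
  by rewrite leq_min cn leq_addr.
have sE : s = c ++ drop (size c) s.
  rewrite -{1}(cat_take_drop (size c) s); congr (_ ++ _).
  by rewrite -(takel_cat r cs) srE take_size_cat.
move: srE sF; rewrite sE; move: (drop _ s) => d {s sE cs k rsr}.
rewrite -catA => /(congr1 (drop (size c))); rewrite !drop_size_cat // => rE.
rewrite -{}rE catA in rpr; rewrite all_cat => /andP[_ dF].
exists (p1 ++ d); split=> //; last by rewrite all_cat p1F.
  rewrite pE -catA (catA (invs c)) -reduce_catr -(reduce_catl (invs c ++ c)).
  by rewrite reduce_invsl /= reduce_catr reduce_id //; apply: reduced_catl rpr.
by rewrite !size_cat p1c.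
Qed.

Lemma elem_map_surj a : kernel_on a -> exists w : Y, elem_map w = a.
Proof.
case: a => p y [/kernelP[Ky py h] [/= pF pn]].
have [b [u [s [bu yE bF hb [k hs]]]]] := extract y.
pose j : J := (size (pseq b), lambda u, s).
have pb : pter p = porg b by rewrite py yE lambda_act.
have Ku : K u by rewrite -(actVK bu) -yE; apply: Kinv; rewrite ?pter_pinv -?pb.
have Zu : tails j u by split.
move: h; rewrite yE => /(evt_act _ bu) h.
have [q [[qb eq] [/= rq hq]]] := evt_ex (evtI h (evtI hb hs)).
rewrite /eqlen /= pseq_pmul // (reduce_id rq) in eq.
have rb : reduced (pseq b ++ s).
  rewrite -hq; have /prefixP[r qr] := headF_prefix (pseq q).
  by move: rq; rewrite {1}qr catA; apply: reduced_catl.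
have [] := eqlen_extract (rpath_reduced p) rq pF bF pn _ eq.
  by rewrite hq.
move=> c [cE sc cF rc].
have pbj : pmul p b \in paths j.
  rewrite mem_paths pseq_pmul // cE sc cF pter_pmul // bu !eqxx /=.
  have /prefixP[r qr] := headF_prefix (pseq q).
  by move: rc; rewrite qr catA hq; apply: reduced_catl.
have bj : b \in paths j by rewrite mem_paths bF bu !eqxx.
have [i1 e1] := path_at_ex (k : compat j.1.1 j.2) pbj.
have [i2 e2] := path_at_ex (k : compat j.1.1 j.2) bj.
exists (elem_mk (tail_point Zu) i1 i2).
by rewrite /elem_map /= e1 e2 pmulK // yE.
Qed.

Lemma elem_map_continuous : continuous elem_map.
Proof.
move=> [j [u [a b]]] O /nbhs_pairP nO; have [bu _ _ _ _] := tails_path u b.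
have [V Vu VO] : exists2 V, nbhs u V & forall u' : tail_space j, V u' ->
    O (elem_map (elem_mk u' a b)).
  exists [set u' : tail_space j | O (elem_map (elem_mk u' a b))] => //.
  apply/nbhs_set_typeP; eexists; first exact: (act_nbhs bu nO).
  by move=> u' [_].
exists (V, [set (a, b)]) => /=; first by split=> //; apply: discrete_set1.
by move=> [u' _] /= [/VO Vu' ->].
Qed.

Lemma elem_map_open (U : set Y) : open U -> open_in kernel_on (elem_map @` U).
Proof.
(* The largest open set whose trace on [kernel_on] lies in the image; it remains to find such a
   neighbourhood of each image point. *)
move=> oU; pose W : set X := \bigcup_(V in [set V : set X | open V /\
  kernel_on `&` V `<=` elem_map @` U]) V.
exists W; first by apply: bigcup_open => V [].
apply/seteqP; split=> [_ [w Uw <-]|c [Lc [V [_ VU] Vc]]]; last exact: VU.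
split; first exact: elem_map_in.
case: w Uw => j [u [a b]] Uw; have [bu _ _ _ _] := tails_path u b.
have [Ku lu hu] := set_valP u.
have nU : nbhs u [set u' : tail_space j | U (elem_mk u' a b)].
  have /= [[A B] /= [uA abB] AB] : nbhs (elem_mk u a b) U.
    exact: open_nbhs_nbhs.
  apply: filterS uA => u' Au'; apply: (AB (u', (a, b))); split=> //=.
  exact: nbhs_singleton abB.
have [O uO OU] := (nbhs_set_typeP _ _).1 nU.
pose y := act (path_at b) (\val u).
pose p := pmul (path_at a) (pinv (path_at b)).
have by_ : pter (pinv (path_at b)) = lambda y by rewrite pter_pinv lambda_act.
(* With the invariance of [K], these conditions put the translated point into [tails j], and [O]
   then gives membership in [U]. *)
pose N := O `&` [set u' | lambda u' = j.1.2] `&`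
  [set u' | evt u' [set q | headF (pseq q) = j.2]].
have nN : nbhs (act (pinv (path_at b)) y) N.
  rewrite actVK //; apply: filterI.
    by apply: filterI => //; rewrite -lu; apply: nbhs_lambda.
  by apply: open_nbhs_nbhs; split=> //; apply: open_evt.
have : nbhs (p, y) [set c : X | c.1 = p /\
    pter (pinv (path_at b)) = lambda c.2 /\ N (act (pinv (path_at b)) c.2)].
  by apply/nbhs_pairP; apply: filterS (act_nbhs by_ nN) => z Nz.
rewrite nbhsE => -[V [oV Vy] VN]; exists V => //; split=> //.
move=> [p' z] [[[[/= Kz _] _] _] /VN[/= -> [bz [[Oz lz] hz]]]].
have Kz' : K (act (pinv (path_at b)) z) by apply: Kinv.
have Zz : tails j (act (pinv (path_at b)) z) by [].
exists (elem_mk (tail_point Zz) a b); first exact: OU.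
by rewrite /elem_map /= actKV // -bz pter_pinv.
Qed.

Lemma kernel_on_elementary : is_elementary D kernel_on.
Proof.
exists J, tail_space, npaths; split.
  move=> j; split; first exact: tail_space_hausdorff.
  exact: tail_space_locally_compact.
exists elem_map; split.
- split=> [w _|w w' _ _|a /elem_map_surj[w <-]]; first exact: elem_map_in.
    exact: elem_map_inj.
  by exists w.
- exact: elem_map_continuous.
- exact: elem_map_open.
- move=> [j [u [a b]]]; have [au _ _ _ _] := tails_path u a.
  have [bu _ _ _ _] := tails_path u b; rewrite /elem_map /=.
  have ab : pter (path_at a) = porg (pinv (path_at b)) by rewrite porg_pinv au.
  have e : act (pmul (path_at a) (pinv (path_at b)))
      (act (path_at b) (\val u)) = act (path_at a) (\val u).
    rewrite act_mul ?pter_pmul ?pter_pinv // -pmulA ?pter_pinv // pmulVp.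
    by rewrite pmulp1 // au.
  by rewrite e !pmulpV !lambda_act.
- move=> [j [u [a b]]] [j' [u' [a' b']]] e.
  have jj : j = j' := congr1 (@projT1 _ _) e.
  subst j'; have [uu ba _] := Tagged_inj e; clear e; subst u' a'.
  rewrite /elem_map /= tagged_asE /=.
  have [au _ _ _ _] := tails_path u a; have [bu _ _ _ _] := tails_path u b.
  have [bu' _ _ _ _] := tails_path u b'; congr pair.
  rewrite -pmulA ?pter_pinv ?porg_pmul ?porg_pinv ?bu ?bu' //.
  by rewrite pmulVK ?porg_pinv ?bu ?bu'.
Qed.

(** Equal lengths mean that the cancelled block and its replacement have the same size, at most [n]
    because together they make up [t]. *)
Lemma drop_eqlen t s : reduced t -> reduced s -> size t <= n.*2 ->
  size (reduce (t ++ s)) = size s -> drop n (reduce (t ++ s)) = drop n s.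
Proof.
move=> rt rs tn; have [t' [c [r [tE -> ->]]]] := reduce_cat_split rt rs.
rewrite !size_cat => /addIn sc.
have cn : size c <= n.
  by move: tn; rewrite tE size_cat size_invs sc addnn leq_double.
by rewrite !drop_cat sc ltnNge cn.
Qed.

(** The delicate point is the length bound for a product. Along a common word [u] each factor alters
    the first [n] letters only, so [p q] is [take n w] times the inverse of [take n u], where [w] is
    the word of [p q u]. *)
Lemma kernel_on_subgroupoid : is_subgroupoid D kernel_on H.
Proof.
have [Hs Hr Hi Hm] := kernel_closed Kinv; split; first by move=> a [].
split.
- by move=> a [Ha _]; split; [apply: Hs | ].
- by move=> a [Ha _]; split; [apply: Hr | ].
- move=> a [Ha [aF an]]; split; first exact: Hi.
  by rewrite /= pseq_pinv size_invs all_invs.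
- move=> [p y'] [q y] [Hp [/= pF pn]] [Hq [/= qF qn]] pq.
  split; first exact: (Hm _ _ Hp Hq pq).
  have yE : y' = act q y by case: pq.
  move: Hp Hq; rewrite yE => /kernelP[_ py hp] /kernelP[_ qy hq].
  rewrite lambda_act // in py; move/(evt_act _ qy): hp => hp.
  have [u [[/= uq eu'] eu]] := evt_ex (evtI hp hq).
  rewrite /eqlen /= in eu' eu; rewrite pseq_pmul ?uq // in eu'.
  have d1 := drop_eqlen (rpath_reduced p) (reduce_reduced _) pn eu'.
  have d2 := drop_eqlen (rpath_reduced q) (rpath_reduced u) qn eu.
  rewrite pseq_pmul //; split; first by apply: all_reduce; rewrite all_cat pF.
  set w := reduce (pseq p ++ reduce (pseq q ++ pseq u)) in d1.
  (* By [d1] and [d2] the words [w] and [u] agree after [n] letters, so these parts cancel in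
     [w u^-1]. *)
  have -> : reduce (pseq p ++ pseq q) =
      reduce (take n w ++ invs (take n (pseq u))).
    transitivity (reduce (w ++ invs (pseq u))).
      have -> : w = reduce ((pseq p ++ pseq q) ++ pseq u).
        by rewrite /w reduce_catr catA.
      by rewrite reduce_catl -catA -[RHS]reduce_catr reduce_invsr cats0.
    rewrite -{1}(cat_take_drop n w) -{1}(cat_take_drop n (pseq u)) d1 d2.
    rewrite invs_cat -catA (catA (drop n _)) -reduce_catr.
    by rewrite -(reduce_catl (drop n _ ++ _)) reduce_invsr reduce_catr.
  rewrite (leq_trans (size_reduce _)) // size_cat size_invs -addnn.
  by rewrite leq_add // size_take_min geq_minl.
Qed.

Lemma kernel_on_open : open_in H kernel_on.
Proof.
exists [set a | all [in F] (pseq a.1) /\ size (pseq a.1) <= n.*2] => //.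
apply/open_pairP => p /=.
have [h|h] := pselect (all [in F] (pseq p) /\ size (pseq p) <= n.*2).
  rewrite (_ : [set z | _] = setT); first exact: openT.
  by apply/seteqP; split.
rewrite (_ : [set z | _] = set0); first exact: open0.
by apply/seteqP; split.
Qed.

End Elementary.

(** * The kernel as a directed union of elementary subgroupoids *)

Theorem proposition2p27 (E : digraph) (K : set (spec (forest_of E)))
    (Kclosed : closed K) (Kinv : invariant_set K) :
  is_AF (transf_ops E) (cocycle_kernel K).
Proof.
split; [exact: kernel_etale | exact: kernel_principal |
  exact: kernel_totally_disconnected |].
exists [set L | exists F n,
  {in F, forall e, ebar e \in F} /\ L = kernel_on F n K].
split.
- by exists (kernel_on [::] 0 K), [::], 0; split.
- move=> _ _ [F [n [Fb ->]]] [F' [n' [Fb' ->]]].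
  exists (kernel_on (F ++ F') (n + n') K).
    exists (F ++ F'), (n + n'); split=> // e.
    by rewrite !mem_cat => /orP[/Fb->|/Fb'->]; rewrite ?orbT.
  have mono G m : {subset G <= F ++ F'} -> m <= n + n' ->
      kernel_on G m K `<=` kernel_on (F ++ F') (n + n') K.
    move=> GF mn a [Ha [aG am]]; split=> //; split.
      by apply: sub_all aG => e; apply: GF.
    by rewrite (leq_trans am) // leq_double.
  by move=> a [|]; apply: mono; rewrite ?leq_addr ?leq_addl // => e eF;
    rewrite mem_cat eF ?orbT.
- move=> _ [F [n [Fb ->]]]; split; first exact: kernel_on_subgroupoid.
    exact: kernel_on_open.
  exact: kernel_on_elementary.
apply/seteqP; split=> [a Ha|a [L [F [n [_ ->]]] []//]].
(* Adding the reverses closes the list under reversal. The length of the path serves as [n], as it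
   is at most its double. *)
pose F := pseq a.1 ++ map (@ebar E) (pseq a.1).
exists (kernel_on F (size (pseq a.1)) K).
  exists F, (size (pseq a.1)); split=> // e; rewrite !mem_cat.
  case/orP=> [ea|/mapP[f fa ->]]; first by rewrite map_f ?orbT.
  by rewrite ebarK fa.
split=> //; split; last by rewrite -addnn leq_addr.
by apply/allP => e ea; rewrite mem_cat ea.
Qed.
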